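(* Let $\mathfrak{g}$ be a finite dimensional simple complex Lie algebra, let $\alpha$ be a simple root and $k$ its coefficient in the decomposition of the maximal root $\alpha_{\max}$ as a combination of simple roots. Let $a(u)=\frac{1}{1-u}$. There exists a one-to-one correspondence between Lagrangian subalgebras $W$ of $\mathfrak{g}((u))$, with respect to $Q_{a(u)}$, which are transversal to $\mathfrak{g}[[u]]$ and satisfy $W\subseteq \mathbb{O}_{\alpha}\cap\mathfrak{g}[u,u^{-1}]$, and Lagrangian subalgebras in $L_{\alpha}\oplus\mathfrak{g}$, with respect to $\bar{Q}$, transversal to $\Delta_{\alpha,\alpha_{\max}}$.
   Context: $\mathfrak{g}$ has a fixed Cartan subalgebra $\mathfrak{h}$, root system $R$, set of simple roots $\Gamma=\{\alpha_i\}$, root spaces $\mathfrak{g}_\beta$, and maximal root $\alpha_{\max}=\sum_j k_j\alpha_j$. A root ''contains'' $\alpha$ if its coefficient at $\alpha$ in the expansion in simple roots is non-zero. $K$ denotes the Killing form of $\mathfrak{g}$, and also its $\mathbb{C}((u))$-bilinear extension to $\mathfrak{g}((u))$. The form on $\mathfrak{g}((u))$: $Q_{a(u)}(f_1,f_2)=\mathrm{Res}_{u=0}(a(u)K(f_1(u),f_2(u)))$, where $a(u)$ is regarded as a Taylor series at $u=0$. The maximal order $\mathbb{O}_\alpha$: let $\mathfrak{h}(\mathbb{R})=\{h\in\mathfrak{h}:\beta(h)\in\mathbb{R}\ \forall\beta\in R\}$, and let $v$ be the valuation on $\mathbb{C}((u^{-1}))$ with $v(\sum_{m\ge n}a_mu^{-m})=n$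 when $a_n\ne0$ (and $v(0)=+\infty$). For $h\in\mathfrak{h}(\mathbb{R})$ and $\beta\in R$ put $M_\beta(h)=\{f\in\mathbb{C}((u^{-1})):v(f)\ge\beta(h)\}$ and $\mathbb{O}_h=\mathfrak{h}[[u^{-1}]]\oplus\bigoplus_{\beta\in R}M_\beta(h)\otimes\mathfrak{g}_\beta$. For $\alpha=\alpha_j$ set $\mathbb{O}_\alpha=\mathbb{O}_{h_j}$, where $h_j\in\mathfrak{h}(\mathbb{R})$ is defined by $\alpha_i(h_j)=\delta_{ij}/k_j$ for all $i$. The intersection $\mathbb{O}_\alpha\cap\mathfrak{g}[u,u^{-1}]$ is taken in $\mathfrak{g}((u^{-1}))$, and $\mathfrak{g}[u,u^{-1}]$ is also viewed inside $\mathfrak{g}((u))$. For $-k\le r\le k$ let $R_r$ be the set of roots whose coefficient at $\alpha$ is $r$; put $\mathfrak{g}_0=\mathfrak{h}\oplus\sum_{\beta\in R_0}\mathfrak{g}_\beta$ and $\mathfrak{g}_r=\sum_{\beta\in R_r}\mathfrak{g}_\beta$ for $r\ne0$. $L_\alpha=\mathfrak{g}_k+\mathfrak{g}_0+\mathfrak{g}_{-k}$ is the Lie subalgebra of $\mathfrak{g}$ (containing $\mathfrak{h}$) whose Dynkin diagram is obtained from the extended Dynkin diagram of $\mathfrak{g}$ by erasing $\alpha$; its simple roots are $(\Gamma\setminus\{\alpha\})\cup\{-\alpha_{\max}\}$. The form $\bar{Q}((x_1,y_1),(x_2,y_2))=K(x_1,x_2)-K(y_1,y_2)$ on $\mathfrak{g}\oplus\mathfrak{g}$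 restricts to a nondegenerate form on $L_\alpha\oplus\mathfrak{g}$, also denoted $\bar{Q}$. $P_\alpha^-$ is the standard parabolic subalgebra of $\mathfrak{g}$ spanned by $\mathfrak{h}$, the root spaces of all negative roots and the root spaces of all positive roots which do not contain $\alpha$, so $P_\alpha^-=\mathfrak{g}_0+\mathfrak{g}_{-1}+\dots+\mathfrak{g}_{-k}$. $P^+_{\alpha_{\max}}=\mathfrak{g}_0+\mathfrak{g}_{-k}$ is the standard parabolic subalgebra of $L_\alpha$ corresponding to its simple root $-\alpha_{\max}$. Both have reductive part $\mathfrak{g}_0$; the reductive part of an element is its component in $\mathfrak{g}_0$. $\Delta_{\alpha,\alpha_{\max}}$ is the set of pairs $(x,y)\in P^+_{\alpha_{\max}}\times P_\alpha^-$ with equal reductive parts. A Lie subalgebra $W$ is Lagrangian with respect to a nondegenerate invariant bilinear form if $W=W^\perp$. Two subspaces are transversal if the ambient space is their direct sum. *)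

(* Defs.v *)
From mathcomp Require Import all_boot all_order all_algebra.
From mathcomp Require Import complex.
From mathcomp Require Import all_classical all_reals.

Set Implicit Arguments.
Unset Strict Implicit.
Unset Printing Implicit Defensive.

Import Order.TTheory GRing.Theory Num.Theory.

Local Open Scope classical_set_scope.
Local Open Scope ring_scope.
Local Open Scope complex_scope.

Section LinearSets.
Variables (F : fieldType) (V : lmodType F).
Implicit Types (E A B W : set V) (brk : V -> V -> V) (Q : V -> V -> F).

Definition sum_set A B : set V := [set x + y | x in A & y in B].

(* The sum of a finite family of subspaces; [D] is meant to be finite
   (a sum over [\in] is 0 when its support is infinite). *)
Definition sum_family (I : choiceType) (D : set I) (S : I -> set V) : set V :=
  [set x | exists2 f : I -> V,
     (forall i, D i -> S i (f i)) & x = \sum_(i \in D) f i].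

Definition transversal_in E A B : Prop :=
  E = sum_set A B /\ A `&` B = [set 0].

Definition orthogonal_in E Q W : set V :=
  [set x | E x /\ forall w, W w -> Q x w = 0].

Definition lie_subalgebra E brk W : Prop :=
  [/\ W `<=` E, W 0,
      forall (a : F) x y, W x -> W y -> W (a *: x + y)
    & forall x y, W x -> W y -> W (brk x y)].

Definition lagrangian_subalgebra E brk Q W : Prop :=
  lie_subalgebra E brk W /\ W = orthogonal_in E Q W.

End LinearSets.

(* A formal series [sum_n f_n u^n] with coefficients in [V] is the function
   [f : int -> V].  Thus V((u)), V((u^-1)), V[[u]], V[[u^-1]] and V[u,u^-1] are
   sets of functions [int -> V], singled out by a condition on the support;
   for a finite dimensional Lie algebra [g], [laurent g] is g((u)). *)
Section Series.
Variable V : zmodType.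

Definition laurent : set (int -> V) :=
  [set f | exists N : int, forall n : int, n < N -> f n = 0].

Definition laurent_inf : set (int -> V) :=
  [set f | exists N : int, forall n : int, N < n -> f n = 0].

Definition laurent_poly : set (int -> V) := laurent `&` laurent_inf.

Definition taylor : set (int -> V) :=
  [set f | forall n : int, n < 0 -> f n = 0].

Definition residue (f : int -> V) : V := f (-1).

End Series.

Arguments laurent : clear implicits.
Arguments laurent_inf : clear implicits.
Arguments laurent_poly : clear implicits.
Arguments taylor : clear implicits.

(* The coefficientwise (Cauchy product) extension of a biadditive map; on pairs
   of elements of U((u)) and V((u)) all the sums are finite. *)
Definition cauchy (U V W : zmodType) (m : U -> V -> W)
    (f : int -> U) (g : int -> V) : int -> W :=
  fun n => \sum_(i \in setT) m (f i) (g (n - i)).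

(* The Taylor series of 1 / (1 - u) at u = 0. *)
Definition inv_one_minus_u (F : fieldType) : int -> F :=
  fun n => if 0 <= n then 1 else 0.

Arguments inv_one_minus_u : clear implicits.

Section LieAlgebra.
Variables (R : realType) (g : vectType R[i]) (br : g -> g -> g).

Definition lie_bracket : Prop :=
  [/\ forall (a : R[i]) x y z, br (a *: x + y) z = a *: br x z + br y z,
      forall (a : R[i]) x y z, br x (a *: y + z) = a *: br x y + br x z,
      forall x, br x x = 0
    & forall x y z, br x (br y z) + br y (br z x) + br z (br x y) = 0].

Definition lie_ideal (I : {vspace g}) : Prop :=
  forall x y, y \in I -> br x y \in I.

Definition simple_lie_algebra : Prop :=
  (exists x y, br x y != 0) /\
  forall I : {vspace g}, lie_ideal I -> I = 0%VS \/ I = fullv.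

Definition killing (x y : g) : R[i] :=
  let b := vbasis (fullv : {vspace g}) in
  \tr (passmx.mxof b b (linfun (br x) \o linfun (br y))%VF).

Definition abelian_subspace (A : {vspace g}) : Prop :=
  forall x y, x \in A -> y \in A -> br x y = 0.

Definition ad_semisimple (x : g) : Prop :=
  exists2 b : seq g, basis_of fullv b &
    forall y, y \in b -> exists c : R[i], br x y = c *: y.

(* Cartan subalgebras of a semisimple complex Lie algebra: the maximal abelian
   subalgebras all of whose elements are ad-semisimple. *)
Definition cartan_subalgebra (h : {vspace g}) : Prop :=
  [/\ abelian_subspace h,
      forall A : {vspace g}, (h <= A)%VS -> abelian_subspace A -> A = h
    & forall x, x \in h -> ad_semisimple x].

Definition dual (h : {vspace g}) := 'Hom(subvs_of h, R[i]^o).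

Section Roots.
Variable h : {vspace g}.
Implicit Types beta : dual h.

Definition root_space beta : set g :=
  [set x | forall t : subvs_of h, br (vsval t) x = (beta t : R[i]) *: x].

Definition is_root : set (dual h) :=
  [set beta | beta != 0 /\ exists2 x, root_space beta x & x != 0].

Variables (n : nat) (Gamma : n.-tuple (dual h)).

Definition positive_root : set (dual h) :=
  [set beta | is_root beta /\
     forall i, exists m : nat, coord Gamma i beta = m%:R :> R[i]].

Definition negative_root : set (dual h) :=
  [set beta | is_root beta /\
     forall i, exists m : nat, coord Gamma i beta = - m%:R :> R[i]].

Definition simple_roots : Prop :=
  [/\ basis_of fullv Gamma,
      forall i, is_root (tnth Gamma i)
    & forall beta, is_root beta -> positive_root beta \/ negative_root beta].

Definition maximal_root (amax : dual h) : Prop :=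
  is_root amax /\
  forall beta i, is_root beta ->
    (coord Gamma i beta : R[i]) <= coord Gamma i amax.

Definition real_cartan : set (subvs_of h) :=
  [set t | forall beta, is_root beta -> (beta t : R[i]) \is Num.real].

(* [valuation_inf f m]: the u^-1-adic valuation of f is the integer m;
   no m satisfies this when f = 0, whose valuation is +oo. *)
Definition valuation_inf (f : int -> R[i]) (m : int) : Prop :=
  f (- m) != 0 /\ forall l : int, l < m -> f (- l) = 0.

Definition M_ beta (t : subvs_of h) : set (int -> R[i]) :=
  [set f | laurent_inf R[i] f /\
     forall m, valuation_inf f m -> (beta t : R[i]) <= m%:~R].

(* The image in series with coefficients in g of M (x) S, where f (x) x is
   identified with the series [fun n => f n *: x]. *)
Definition tensor_set (M : set (int -> R[i])) (S : set g) : set (int -> g) :=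
  [set F | exists (m : nat) (f : 'I_m -> int -> R[i]) (x : 'I_m -> g),
     (forall i, M (f i) /\ S (x i)) /\
     F = fun n => \sum_(i < m) f i n *: x i].

Definition cartan_taylor_inf : set (int -> g) :=
  [set F | (forall n : int, F n \in h) /\ forall n : int, 0 < n -> F n = 0].

Definition O_h (t : subvs_of h) : set (int -> g) :=
  sum_set cartan_taylor_inf
    (sum_family is_root (fun beta => tensor_set (M_ beta t) (root_space beta))).

Variables (amax : dual h) (j : 'I_n).

(* h_j: the element of h(R) with alpha_i(h_j) = delta_ij / k_j for all i. *)
Definition h_ : subvs_of h :=
  xget 0 [set t | real_cartan t /\
    forall i, (tnth Gamma i t : R[i]) = (i == j)%:R / coord Gamma j amax].

Definition O_alpha : set (int -> g) := O_h h_.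

Definition root_sum (D : set (dual h)) : set g := sum_family D root_space.

Definition cartan_root_sum (D : set (dual h)) : set g :=
  sum_set [set x | x \in h] (root_sum D).

(* The degree r is taken in C, so that it can be the coordinate [k] of
   [amax]; only integer degrees occur. *)
Definition graded_roots (r : R[i]) : set (dual h) :=
  [set beta | is_root beta /\ coord Gamma j beta = r].

Definition g_ (r : R[i]) : set g :=
  if r == 0 then cartan_root_sum (graded_roots 0)
  else root_sum (graded_roots r).

Let k : R[i] := coord Gamma j amax.

Definition L_alpha : set g := sum_set (sum_set (g_ k) (g_ 0)) (g_ (- k)).

Definition P_alpha_minus : set g :=
  cartan_root_sum (negative_root `|`
    [set beta | positive_root beta /\ coord Gamma j beta = 0]).

Definition P_alphamax_plus : set g := sum_set (g_ 0) (g_ (- k)).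

(* [z] is the component of [x] in g_0 for g = g_0 + sum_(r <> 0) g_r. *)
Definition reductive_part (x z : g) : Prop :=
  g_ 0 z /\
  root_sum [set beta | is_root beta /\ coord Gamma j beta != 0] (x - z).

Definition Delta : set (g * g) :=
  [set p | [/\ P_alphamax_plus p.1, P_alpha_minus p.2 &
     exists2 z, reductive_part p.1 z & reductive_part p.2 z]].

End Roots.

Definition loop_bracket (f1 f2 : int -> g) : int -> g := cauchy br f1 f2.

Definition Q_ (a : int -> R[i]) (f1 f2 : int -> g) : R[i] :=
  residue (cauchy *%R a (cauchy killing f1 f2)).

Definition pair_bracket (p q : g * g) : g * g := (br p.1 q.1, br p.2 q.2).

Definition Qbar (p q : g * g) : R[i] := killing p.1 q.1 - killing p.2 q.2.

End LieAlgebra.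

(* Main.v *)
From HB Require Import structures.
Require Import Defs.
From mathcomp Require Import all_boot all_order all_algebra.
From mathcomp Require Import complex.
From mathcomp Require Import all_classical all_reals.
From mathcomp Require Import zify.

(** Write k for the coefficient of alpha in the maximal root, and let t in the
    Cartan subalgebra be the point where alpha takes the value 1 and the other
    simple roots vanish.  The operator ad t grades g by the coefficient of a
    root at alpha; all degrees lie between -k and k.  A loop x u^n with x of
    degree r then gets the total degree k n + r, and the Laurent polynomials of the
    maximal order are the Laurent series all of whose components have
    nonpositive total degree ([O_alphaE]).

    On this algebra A of loops there are two Lie algebra homomorphisms: the
    projection onto the components of total degree 0, whose values
    g_{-k} u + g_0 + g_k u^-1 form a copy of L_alpha, and the evaluation at
    u = 1, the pole of a(u).  Together they give a surjection phi from A onto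
    L_alpha (+) g ([loop_specialization]).  The form Q takes the sum of the
    coefficients of K(f1, f2) at negative powers of u.  The sum of all
    coefficients is K(f1(1), f2(1)); those at positive powers vanish because K
    pairs only opposite degrees, and the one at u^0 involves only total
    degree 0.
    So Q is minus the pullback of Qbar along phi ([loop_form_specialization]).
    The orthogonal of ker phi is A: on loops divisible by 1 - u the factor
    a(u) disappears from Q, so that Q reads off single coefficients
    ([loop_form_difference]).

    Hence W and phi(W) determine each other: a Lagrangian W inside A contains
    the orthogonal of A, which contains ker phi, and the inverse image of a
    Lagrangian subalgebra is Lagrangian ([lagrangian_reduction_bij]).  Finally
    phi maps the Taylor series in A bijectively onto Delta, and A together with
    the Taylor series spans g((u)), which exchanges the two transversality
    conditions.

    The Lie theory needed is that g is the sum of its weight spaces, by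
    simultaneous diagonalization, and that the Killing form is nondegenerate:
    the radical of K is an ideal of a simple algebra, and K <> 0 because, on a
    point of the Cartan subalgebra where every simple root is 1, K is the sum
    of the squares of the integral eigenvalues of ad, not all of which vanish
    ([killing_neq0]). *)

Set Implicit Arguments.
Unset Strict Implicit.
Unset Printing Implicit Defensive.

Import Order.TTheory GRing.Theory Num.Theory.

Local Open Scope classical_set_scope.
Local Open Scope ring_scope.
Local Open Scope complex_scope.

(** * Lagrangian subalgebras under reduction by a Lie homomorphism *)

(** Here A is a subspace of E on which phi is a Lie homomorphism onto E' that
    carries the form Q to - Q'; the orthogonal of its kernel is assumed to lie
    in A.  The subspaces T and D are the transversality tests on both sides. *)
Section Correspondence.
Variables (F : fieldType) (V V' : lmodType F).
Variables (E A T : set V) (E' D : set V').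
Variables (brk : V -> V -> V) (brk' : V' -> V' -> V').
Variables (Q : V -> V -> F) (Q' : V' -> V' -> F) (phi : V -> V').
Hypothesis E_lin : forall a x y, E x -> E y -> E (a *: x + y).
Hypothesis A_lin : forall a x y, A x -> A y -> A (a *: x + y).
Hypothesis A0 : A 0.
Hypothesis T_lin : forall a x y, T x -> T y -> T (a *: x + y).
Hypothesis T0 : T 0.
Hypothesis AE : A `<=` E.
Hypothesis TE : T `<=` E.
Hypothesis A_brk : forall x y, A x -> A y -> A (brk x y).
Hypothesis phi_lin :
  forall a x y, A x -> A y -> phi (a *: x + y) = a *: phi x + phi y.
Hypothesis phi_brk :
  forall x y, A x -> A y -> phi (brk x y) = brk' (phi x) (phi y).
Hypothesis phi_img : phi @` A = E'.
Hypothesis phi_form :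
  forall x y, A x -> A y -> Q x y = - Q' (phi x) (phi y).
Hypothesis form_lin0 : forall x, Q' 0 x = 0.
Hypothesis orth_ker :
  forall x, E x -> (forall y, A y -> phi y = 0 -> Q x y = 0) -> A x.
Hypothesis E_AT : E = sum_set A T.
Hypothesis phi_D : phi @` (A `&` T) = D.
Hypothesis phi_inj : forall x, A x -> T x -> phi x = 0 -> x = 0.

Let phi0 : phi 0 = 0.
Proof.
have := phi_lin 1 A0 A0; rewrite scaler0 addr0 scale1r => /eqP.
by rewrite -subr_eq0 opprD addrA subrr sub0r oppr_eq0 => /eqP.
Qed.

Let A_sub x y : A x -> A y -> A (x - y).
Proof. by move=> Ax Ay; rewrite addrC -scaleN1r; exact: A_lin. Qed.

Let phi_sub x y : A x -> A y -> phi (x - y) = phi x - phi y.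
Proof. by move=> Ax Ay; rewrite addrC -scaleN1r phi_lin// scaleN1r addrC. Qed.

(** The kernel is orthogonal to A, hence to W, and W is its own orthogonal. *)
Lemma lagrangian_contains_ker W :
  lagrangian_subalgebra E brk Q W -> W `<=` A ->
  forall x, A x -> phi x = 0 -> W x.
Proof.
move=> [_ WE] WA x Ax px; rewrite WE; split; first exact: AE.
by move=> w /WA Aw; rewrite phi_form// px form_lin0 oppr0.
Qed.

Lemma lagrangian_saturated W :
  lagrangian_subalgebra E brk Q W -> W `<=` A ->
  forall x, A x -> (phi @` W) (phi x) -> W x.
Proof.
move=> LW WA x Ax [w Ww pw]; have [[_ W0 Wlin _] _] := LW.
have : W (x - w).
  apply: (lagrangian_contains_ker LW WA).
    by apply: A_sub => //; exact: WA.
  by rewrite phi_sub// ?pw ?subrr//; exact: WA.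
by move=> /(Wlin 1 _ _)/(_ Ww); rewrite scale1r subrK.
Qed.

Lemma image_lagrangian W :
  lagrangian_subalgebra E brk Q W -> W `<=` A ->
  lagrangian_subalgebra E' brk' Q' (phi @` W).
Proof.
move=> LW WA; have [[WE W0 Wlin Wbrk] WO] := LW.
split; first split.
- by move=> _ [w /WA Aw <-]; rewrite -phi_img; exists w.
- by exists 0; rewrite ?phi0.
- move=> a _ _ [x Wx <-] [y Wy <-]; exists (a *: x + y); first exact: Wlin.
  by apply: phi_lin; exact: WA.
- move=> _ _ [x Wx <-] [y Wy <-]; exists (brk x y); first exact: Wbrk.
  by apply: phi_brk; exact: WA.
apply/seteqP; split.
  move=> _ [x Wx <-]; split.
    by rewrite -phi_img; exists x => //; exact: WA.
  move=> _ [y Wy <-]; apply: oppr_inj; rewrite -phi_form ?oppr0; try exact: WA.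
  by move: Wx; rewrite {1}WO => -[_]; apply.
move=> x' [+ x'O]; rewrite -phi_img => -[x Ax xx']; exists x => //.
rewrite WO; split; first exact: AE.
move=> w Ww; rewrite phi_form ?xx' ?x'O ?oppr0//; last exact: WA.
Qed.

Lemma image_transversal W :
  lagrangian_subalgebra E brk Q W -> W `<=` A ->
  transversal_in E W T -> transversal_in E' (phi @` W) D.
Proof.
move=> LW WA [EWT WT0]; have [[WE W0 Wlin Wbrk] WO] := LW.
split; apply/seteqP; split.
- move=> x'; rewrite -phi_img => -[x Ax <-].
  have : E x by exact: AE.
  rewrite EWT => -[w Ww [s Ts ws]].
  have As : A s by rewrite -(addKr w s) ws addrC; apply: A_sub => //; exact: WA.
  exists (phi w); first by exists w.
  exists (phi s); first by rewrite -phi_D; exists s.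
  by rewrite -ws -[w in RHS]scale1r phi_lin ?scale1r//; exact: WA.
- move=> z [_ [w Ww <-] [d]]; rewrite -phi_D -phi_img => -[s [As Ts] <-] <-.
  exists (1 *: w + s); first by apply: A_lin => //; exact: WA.
  by rewrite phi_lin ?scale1r//; exact: WA.
- move=> _ [[w Ww <-]]; rewrite -phi_D => -[s [As Ts] sw] /=.
  have Ws : W s by apply: (lagrangian_saturated LW WA) => //; exists w.
  have : (W `&` T) s by [].
  by rewrite WT0 => /= s0; rewrite -sw s0 phi0.
- move=> _ ->; split; first by exists 0; rewrite ?phi0.
  by rewrite -phi_D; exists 0; rewrite ?phi0.
Qed.

(** The inverse image contains the kernel, so a vector orthogonal to it is in A
    by [orth_ker], and its image is orthogonal to W'. *)
Lemma preimage_lagrangian W' :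
  lagrangian_subalgebra E' brk' Q' W' ->
  lagrangian_subalgebra E brk Q (A `&` phi @^-1` W').
Proof.
move=> [[W'E W'0 W'lin W'brk] W'O].
split; first split.
- by move=> x [/AE].
- by split=> //=; rewrite phi0.
- move=> a x y [Ax Wx] [Ay Wy]; split; first exact: A_lin.
  by rewrite /= phi_lin//; exact: W'lin.
- move=> x y [Ax Wx] [Ay Wy]; split; first exact: A_brk.
  by rewrite /= phi_brk//; exact: W'brk.
apply/seteqP; split.
  move=> x [Ax Wx]; split; first exact: AE.
  move=> y [Ay Wy]; rewrite phi_form//; apply/eqP; rewrite oppr_eq0; apply/eqP.
  by move: Wx => /=; rewrite {1}W'O => -[_]; apply.
move=> x [Ex xO].
have Ax : A x.
  by apply: orth_ker => // y Ay py; apply: xO; split => //=; rewrite py.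
split=> //=; rewrite W'O; split; first by rewrite -phi_img; exists x.
move=> y' W'y'; have := W'E _ W'y'; rewrite -phi_img => -[y Ay yy'].
rewrite -yy'; apply: oppr_inj; rewrite -phi_form// oppr0.
by apply: xO; split => //=; rewrite yy'.
Qed.

Lemma preimage_transversal W' :
  lagrangian_subalgebra E' brk' Q' W' -> transversal_in E' W' D ->
  transversal_in E (A `&` phi @^-1` W') T.
Proof.
move=> [[W'E W'0 W'lin W'brk] W'O] [E'WD WD0].
split; apply/seteqP; split.
- move=> x; rewrite E_AT => -[a Aa [s Ts <-]].
  have : E' (phi a) by rewrite -phi_img; exists a.
  rewrite E'WD => -[w' W'w' [d]]; rewrite -phi_D => -[r [Ar Tr] <-] wra.
  exists (a - r); last first.
    by exists (1 *: r + s); [exact: T_lin|rewrite scale1r addrA subrK].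
  split; first exact: A_sub.
  by rewrite /= phi_sub// -wra addrK.
- move=> _ [a [Aa _] [s Ts <-]]; rewrite -[a]scale1r.
  by apply: E_lin; [exact: AE|exact: TE].
- move=> x [[Ax Wx] Tx] /=; apply: phi_inj => //.
  have : (W' `&` D) (phi x) by split => //; rewrite -phi_D; exists x.
  by rewrite WD0.
- by move=> _ ->; split => //; split => //=; rewrite phi0.
Qed.

Lemma image_preimage W' : W' `<=` E' -> phi @` (A `&` phi @^-1` W') = W'.
Proof.
move=> W'E; apply/seteqP; split=> [_ [x [Ax Wx] <-]//|x' Wx'].
have := W'E _ Wx'; rewrite -phi_img => -[x Ax xx'].
by exists x => //; split => //=; rewrite xx'.
Qed.

Theorem lagrangian_reduction_bij :
  set_bij
    [set W | [/\ lagrangian_subalgebra E brk Q W, transversal_in E W T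
             & W `<=` A]]
    [set W' | lagrangian_subalgebra E' brk' Q' W' /\ transversal_in E' W' D]
    (fun W => phi @` W).
Proof.
split.
- move=> W [LW TW WA]; split; first exact: image_lagrangian.
  exact: image_transversal.
- move=> W1 W2; rewrite !inE => -[L1 _ A1] [L2 _ A2] W12.
  apply/seteqP; split=> x Wx.
    by apply: (lagrangian_saturated L2 A2); [exact: A1|rewrite -W12; exists x].
  by apply: (lagrangian_saturated L1 A1); [exact: A2|rewrite W12; exists x].
- move=> W' [LW' TW']; exists (A `&` phi @^-1` W').
    split; [exact: preimage_lagrangian|exact: preimage_transversal|].
    by move=> x [].
  by apply: image_preimage; case: LW' => -[].
Qed.

End Correspondence.

(** * Finitely supported sums and formal series *)

Section FiniteSums.

Lemma finite_int_itv (a b : int) : finite_set [set i : int | a <= i <= b].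
Proof.
have -> : [set i : int | a <= i <= b] =
    [set a + i%:Z | i in `I_(`|b - a|%N.+1)] `&` [set i : int | a <= i <= b].
  apply/seteqP; split=> [i /= /andP[ai ib]|i []//].
  split; last by rewrite /= ai ib.
  exists `|i - a|%N; rewrite /=; lia.
by apply: finite_setIl; apply: finite_image; exact: finite_II.
Qed.

Lemma finite_support_itv (V : zmodType) (f : int -> V) (a b : int) :
  (forall i, i < a -> f i = 0) -> (forall i, b < i -> f i = 0) ->
  finite_set (f @^-1` [set~ 0]).
Proof.
move=> fa fb; apply: sub_finite_set (finite_int_itv a b) => i /= fi.
by apply/andP; split; rewrite leNgt; apply/negP => h; apply: fi; auto.
Qed.

(** A sum over an infinite support is 0 by convention, so additivity needs both
    supports to be finite. *)
Lemma fsumD (I : choiceType) (V : zmodType) (f1 f2 : I -> V) :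
  finite_set (f1 @^-1` [set~ 0]) -> finite_set (f2 @^-1` [set~ 0]) ->
  \sum_(i \in [set: I]) (f1 i + f2 i) =
  \sum_(i \in [set: I]) f1 i + \sum_(i \in [set: I]) f2 i.
Proof.
move=> fin1 fin2; pose P := f1 @^-1` [set~ 0] `|` f2 @^-1` [set~ 0].
have Pfin : finite_set P by rewrite finite_setU.
have notP i : ~ P i -> f1 i = 0 /\ f2 i = 0.
  by move=> /not_orP[/= /contrapT -> /contrapT ->].
have widen (f : I -> V) : (forall i, ~ P i -> f i = 0) ->
    \sum_(i \in [set: I]) f i = \sum_(i \in P) f i.
  by move=> f0; apply/esym/fsbig_widen => // i [_ /f0].
rewrite !widen; first exact: fsbig_split.
- by move=> i /notP[].
- by move=> i /notP[].
- by move=> i /notP[f10 f20]; rewrite f10 f20 addr0.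
Qed.

Lemma fsum1 (I : choiceType) (V : zmodType) (f : I -> V) (a : I) :
  (forall i, i != a -> f i = 0) -> \sum_(i \in [set: I]) f i = f a.
Proof.
move=> f0; rewrite -(@fsbig_widen _ _ _ _ [set a] [set: I]) ?fsbig_set1//.
by move=> i [_ /= /eqP ia]; exact: f0.
Qed.

Lemma fsumZ (F : fieldType) (I : choiceType) (V : lmodType F)
    (a : F) (f : I -> V) :
  \sum_(i \in [set: I]) (a *: f i) = a *: \sum_(i \in [set: I]) f i.
Proof.
have [->|a0] := eqVneq a 0.
  by rewrite scale0r fsbig1// => i _; rewrite scale0r.
have -> : finite_support 0 [set: I] f =
    finite_support 0 [set: I] (fun i => a *: f i).
  rewrite /finite_support !unlock; do 2 congr (_ _); congr (_ `&` _).
  apply/seteqP; split=> i /= fi; apply: contra_not fi => /eqP.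
    by rewrite scaler_eq0 (negPf a0) => /eqP.
  by move=> /eqP ->; rewrite scaler0.
by rewrite scaler_sumr.
Qed.

End FiniteSums.

Section Series.
Variable V : zmodType.

Definition monomial (n : int) (x : V) : int -> V :=
  fun l => if l == n then x else 0.

Lemma monomialD n x y : monomial n (x + y) = monomial n x + monomial n y.
Proof.
by apply/funext => l; rewrite fctE /monomial; case: eqP; rewrite ?addr0.
Qed.

Lemma laurentD f1 f2 : laurent V f1 -> laurent V f2 -> laurent V (f1 + f2).
Proof.
move=> [N1 h1] [N2 h2]; exists (Num.min N1 N2) => n nN.
by rewrite fctE h1 ?h2 ?addr0//; lia.
Qed.

Lemma laurent_monomial n x : laurent V (monomial n x).
Proof. by exists n => l ln; rewrite /monomial lt_eqF. Qed.

End Series.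

Section Cauchy.
Variables (U V W : zmodType) (m : U -> V -> W).
Hypothesis mDl : forall x y z, m (x + y) z = m x z + m y z.
Hypothesis mDr : forall x y z, m x (y + z) = m x y + m x z.

Lemma biadd0l z : m 0 z = 0.
Proof. by apply: (addrI (m 0 z)); rewrite -mDl !addr0. Qed.
Lemma biadd0r z : m z 0 = 0.
Proof. by apply: (addrI (m z 0)); rewrite -mDr !addr0. Qed.

Lemma cauchy_support_finite f g n : laurent U f -> laurent V g ->
  finite_set ((fun i => m (f i) (g (n - i))) @^-1` [set~ 0]).
Proof.
move=> [a fa] [b gb]; apply: (@finite_support_itv _ _ a (n - b)) => i ai.
  by rewrite fa// biadd0l.
by rewrite gb ?biadd0r//; lia.
Qed.

Lemma cauchyDl f1 f2 g : laurent U f1 -> laurent U f2 -> laurent V g ->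
  cauchy m (f1 + f2) g = cauchy m f1 g + cauchy m f2 g.
Proof.
move=> l1 l2 lg; apply/funext => n; rewrite [in RHS]fctE /cauchy -fsumD.
- by apply: eq_fsbigr => i _; rewrite -mDl.
- exact: cauchy_support_finite.
- exact: cauchy_support_finite.
Qed.

Lemma cauchyDr f g1 g2 : laurent U f -> laurent V g1 -> laurent V g2 ->
  cauchy m f (g1 + g2) = cauchy m f g1 + cauchy m f g2.
Proof.
move=> lf l1 l2; apply/funext => n; rewrite [in RHS]fctE /cauchy -fsumD.
- by apply: eq_fsbigr => i _; rewrite -mDr.
- exact: cauchy_support_finite.
- exact: cauchy_support_finite.
Qed.

Lemma cauchy_laurent f g : laurent U f -> laurent V g ->
  laurent W (cauchy m f g).
Proof.
move=> [a fa] [b gb]; exists (a + b) => n nab; apply: fsbig1 => i _.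
have [ia|ia] := ltP i a; first by rewrite fa// biadd0l.
by rewrite gb ?biadd0r//; lia.
Qed.

Lemma cauchy0l g : cauchy m 0 g = 0.
Proof. by apply/funext => n; apply: fsbig1 => i _; exact: biadd0l. Qed.

Lemma cauchy0r f : cauchy m f 0 = 0.
Proof. by apply/funext => n; apply: fsbig1 => i _; exact: biadd0r. Qed.

Lemma cauchy_monomialr f n y l :
  cauchy m f (monomial n y) l = m (f (l - n)) y.
Proof.
rewrite /cauchy (fsum1 (a := l - n)) /monomial.
  by rewrite ifT//; lia.
by move=> i il; rewrite ifF ?biadd0r//; lia.
Qed.

Lemma cauchy_monomial a b x y :
  cauchy m (monomial a x) (monomial b y) = monomial (a + b) (m x y).
Proof.
apply/funext => l; rewrite cauchy_monomialr /monomial.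
have -> : (l - b == a) = (l == a + b) by lia.
by case: eqP => // _; rewrite biadd0l.
Qed.

End Cauchy.

(** * Semisimple operators and the Killing form *)

Section LinearAlgebra.
Variables (F : fieldType) (V : vectType F).
Import passmx.

Lemma linfunE (W : vectType F) (f : V -> W) : linear f -> linfun f =1 f.
Proof.
move=> lf; pose l : {linear V -> W} :=
  HB.pack f (GRing.isLinear.Build _ _ _ _ f lf).
exact: (lfunE l).
Qed.

(** The Killing form is defined by the trace in one chosen basis; eigenvalues
    are only visible in an eigenbasis. *)
Lemma trace_mxof_basis (e e' : (\dim {:V}).-tuple V) (f : 'End(V)) :
  basis_of fullv e -> basis_of fullv e' ->
  \tr (mxof e e f) = \tr (mxof e' e' f).
Proof.
move=> be be'.
have -> : mxof e e f = mxof e e' \1 *m (mxof e' e' f *m mxof e' e \1).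
  rewrite -!mxof_comp//; congr mxof; apply/lfunP => x.
  by do !rewrite lfunE/=.
rewrite mxtrace_mulC -mulmxA -mxof_comp//.
have -> : (\1 \o \1)%VF = \1%VF :> 'End(V).
  by apply/lfunP => x; do !rewrite lfunE/=.
by rewrite mxof1 ?mulmx1// (basis_free be').
Qed.

Lemma trace_eigenbasis (e : (\dim {:V}).-tuple V) (f : 'End(V))
    (c : 'I_(\dim {:V}) -> F) :
  basis_of fullv e -> (forall i : 'I_(\dim {:V}), f e`_i = c i *: e`_i) ->
  \tr (mxof e e f) = \sum_i c i.
Proof.
move=> be fe; rewrite /mxtrace; apply: eq_bigr => i _.
rewrite /mxof mxE /= vecof_delta fe !mxE linearZ/=.
by rewrite coord_free ?(basis_free be)// eqxx mulr1.
Qed.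

(** Projections onto eigenspaces as functions of the scalar alone: they vanish
    at the scalars that are not eigenvalues, so the list of eigenvalues can be
    forgotten afterwards. *)
Lemma eigenprojections (D : 'End(V)) (b : seq V) :
  basis_of fullv b -> (forall y, y \in b -> exists c, D y = c *: y) ->
  exists (s : seq F) (P : F -> 'End(V)),
    [/\ forall c x, D (P c x) = c *: P c x,
        forall c d x, D x = c *: x -> P d x = if d == c then x else 0
      & forall x, x = \sum_(c <- s) P c x].
Proof.
move=> bb eig; set m := size b; pose e := in_tuple b : m.-tuple V.
have be : basis_of fullv e by [].
have /choice[c Dc] : forall i : 'I_m, exists c, D e`_i = c *: e`_i.
  by move=> i; apply: eig; rewrite mem_nth.
pose P d x := \sum_(i | c i == d) coord e i x *: e`_i.
have Plin d : linear (P d).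
  move=> a x y; rewrite scaler_sumr -big_split /=; apply: eq_bigr => i _.
  by rewrite linearP scalerDl scalerA.
exists (undup [seq c i | i : 'I_m]), (fun d => linfun (P d)).
split=> [d x|d d' x Dx|x].
- rewrite linfunE// /P linear_sum scaler_sumr/=; apply: eq_bigr => i /eqP <-.
  by rewrite linearZ/= Dc !scalerA mulrC.
- rewrite linfunE// /P.
  have cx i : c i != d -> coord e i x = 0.
    move=> cd; have := congr1 (coord e i) Dx.
    rewrite {1}(coord_basis be (memvf x)) linear_sum/=.
    under eq_bigr do rewrite linearZ/= Dc scalerA.
    rewrite coord_sum_free ?(basis_free be)// linearZ/= mulrC => /eqP.
    by rewrite -subr_eq0 -mulrBl mulf_eq0 subr_eq0 (negPf cd) => /eqP.
  case: eqP => [->|/eqP dd].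
    rewrite [RHS](coord_basis be (memvf x)) [RHS](bigID (fun i => c i == d))/=.
    by rewrite [X in _ = _ + X]big1 ?addr0// => i /cx ->; rewrite scale0r.
  rewrite big1// => i /eqP ci; rewrite cx ?scale0r// ci //.
- under eq_bigr do rewrite linfunE//.
  rewrite {1}(coord_basis be (memvf x)) /P.
  rewrite (exchange_big_dep xpredT)//=; apply: eq_bigr => i _.
  rewrite -big_filter (_ : [seq _ <- _ | _] = [:: c i]) ?big_seq1//.
  rewrite (eq_filter (a2 := pred1 (c i))) ?filter_pred1_uniq ?undup_uniq//.
    by rewrite mem_undup map_f// mem_enum.
  by move=> d /=; rewrite eq_sym.
Qed.

End LinearAlgebra.

Section Killing.
Variables (R : realType) (g : vectType R[i]) (br : g -> g -> g).
Hypothesis br_lie : lie_bracket br.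
Notation K := (killing br).
Import passmx.

Lemma br_linear_r x : linear (br x).
Proof. by move=> a y z; case: br_lie => _ h _ _; exact: h. Qed.
Lemma br_linear_l z : linear (br^~ z).
Proof. by move=> a x y; case: br_lie => h _ _ _; exact: h. Qed.
Notation ad x := (linfun (br x)).

Lemma adE x y : ad x y = br x y.
Proof. by rewrite linfunE//; exact: br_linear_r. Qed.

Lemma ad_linear a x y : ad (a *: x + y) = a *: ad x + ad y.
Proof.
apply/lfunP => z; rewrite add_lfunE scale_lfunE !adE.
exact: br_linear_l.
Qed.

Lemma brDl x y z : br (x + y) z = br x z + br y z.
Proof. by have := br_linear_l z 1 x y; rewrite !scale1r. Qed.
Lemma brDr x y z : br x (y + z) = br x y + br x z.
Proof. by have := br_linear_r x 1 y z; rewrite !scale1r. Qed.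
Lemma brNr x y : br x (- y) = - br x y.
Proof. by rewrite -!adE linearN. Qed.

Lemma br_antisym x y : br x y = - br y x.
Proof.
have [_ _ brxx _] := br_lie; apply/eqP; rewrite -addr_eq0.
by have := brxx (x + y); rewrite brDl !brDr !brxx add0r addr0 => ->.
Qed.

Lemma ad_br x y z : br (br x y) z = br x (br y z) - br y (br x z).
Proof.
have [_ _ _ jac] := br_lie.
have := jac x y z; rewrite [br z (br x y)]br_antisym => /eqP.
by rewrite subr_eq0 => /eqP <-; rewrite (br_antisym z x) brNr.
Qed.

Let b := vbasis (fullv : {vspace g}).
Let bb : basis_of fullv b.
Proof. exact: vbasisP. Qed.

Lemma killing_linear_l a x y z : K (a *: x + y) z = a * K x z + K y z.
Proof.
rewrite /killing ad_linear comp_lfunDl -comp_lfunZl.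
by rewrite linearP/= linearP.
Qed.

Lemma killing_sym x y : K x y = K y x.
Proof. by rewrite /killing !(mxof_comp _ _ bb) mxtrace_mulC. Qed.

Lemma killingDl x y z : K (x + y) z = K x z + K y z.
Proof. by rewrite -[x in LHS]scale1r killing_linear_l mul1r. Qed.
Lemma killingDr x y z : K x (y + z) = K x y + K x z.
Proof. by rewrite killing_sym killingDl !(killing_sym x). Qed.
Lemma killing0l z : K 0 z = 0.
Proof. by apply: (addrI (K 0 z)); rewrite -killingDl !addr0. Qed.
Lemma killingZl a x z : K (a *: x) z = a * K x z.
Proof. by rewrite -[a *: x]addr0 killing_linear_l killing0l addr0. Qed.

Lemma killing_invariant x y z : K (br x y) z = K x (br y z).
Proof.
have adbr u v : ad (br u v) = ((ad u \o ad v) - (ad v \o ad u))%VF.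
  apply/lfunP => w; do !rewrite lfunE/=; rewrite !adE; exact: ad_br.
rewrite /killing !adbr; set X := ad x; set Y := ad y; set Z := ad z.
rewrite comp_lfunDl comp_lfunDr comp_lfunNl comp_lfunNr !linearB/=.
rewrite !(mxof_comp _ _ bb).
rewrite !mulmxA; congr (_ - _).
by rewrite [in LHS]mxtrace_mulC mulmxA.
Qed.

End Killing.

(** * Weight space decomposition *)

Section Weights.
Variables (R : realType) (g : vectType R[i]) (br : g -> g -> g) (h : {vspace g}).
Hypothesis br_lie : lie_bracket br.
Hypothesis h_cartan : cartan_subalgebra br h.
Notation ad x := (linfun (br x)).
Implicit Types (w : dual h) (t : subvs_of h).

Lemma cartan_br0 (s t : g) : s \in h -> t \in h -> br s t = 0.
Proof. by case: h_cartan => hab _ _; exact: hab. Qed.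

Lemma cartan_brCA (s t y : g) : s \in h -> t \in h ->
  br s (br t y) = br t (br s y).
Proof.
move=> hs ht; apply/eqP; rewrite -subr_eq0 -(ad_br br_lie) (cartan_br0 hs ht).
by rewrite (biadd0l (brDl br_lie)).
Qed.

(** An element that commutes with h spans, together with h, an abelian
    subspace, and h is a maximal one. *)
Lemma cartan_maximal x : (forall t, br (vsval t) x = 0) -> x \in h.
Proof.
move=> hx; case: h_cartan => hab hmax _.
have [_ _ brxx _] := br_lie.
suff <- : (h + <[x]>)%VS = h by rewrite (subvP (addvSr _ _))// memv_line.
apply: hmax; first exact: addvSl.
have hx' u : u \in h -> br u x = 0 by move=> hu; have := hx (Subvs hu).
move=> z1 z2 /memv_addP[u hu [_ /vlineP[a ->] ->]].
move=> /memv_addP[v hv [_ /vlineP[c ->] ->]].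
have ZE (e : R[i]) z z' : br z (e *: z') = e *: br z z'.
  by rewrite -!(adE br_lie) linearZ.
rewrite !(brDl br_lie) !(brDr br_lie) hab// !ZE hx'// scaler0 !add0r.
rewrite (br_antisym br_lie _ v) (br_antisym br_lie _ x) !ZE hx'// brxx.
by rewrite !scaler0 oppr0 scaler0 addr0.
Qed.

Lemma cartan_eigenprojections (t : g) : t \in h ->
  exists (s : seq R[i]) (P : R[i] -> 'End(g)),
    [/\ forall c x, br t (P c x) = c *: P c x,
        forall c d x, br t x = c *: x -> P d x = if d == c then x else 0
      & forall x, x = \sum_(c <- s) P c x].
Proof.
case: h_cartan => _ _ hss /hss[b bb eig].
have [s [P [P1 P2 P3]]] : exists (s : seq R[i]) (P : R[i] -> 'End(g)),
    [/\ forall c x, ad t (P c x) = c *: P c x,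
        forall c d x, ad t x = c *: x -> P d x = if d == c then x else 0
      & forall x, x = \sum_(c <- s) P c x].
  apply: eigenprojections bb _ => y /eig[c yc]; exists c.
  by rewrite adE.
exists s, P; split => // c x; first by rewrite -P1 adE.
by move=> y tx; apply: P2; rewrite adE.
Qed.

(** Simultaneous diagonalization: the operators ad t' with t' in h preserve the
    eigenspaces of ad t, so the projections onto these eigenspaces commute with
    ad t' and keep joint eigenvectors of the previous operators. *)
Lemma joint_eigenvectors (ts : seq g) : {subset ts <= h} ->
  forall x, exists ys : seq g,
    (forall y, y \in ys ->
       forall t : g, t \in ts -> exists c, br t y = c *: y) /\
    x = \sum_(y <- ys) y.
Proof.
elim: ts => [_ x|t ts IH tsh x]; first by exists [:: x]; rewrite big_seq1.
have ht : t \in h by apply: tsh; rewrite mem_head.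
have [|ys [ysP xE]] := IH _ x.
  by move=> u uts; apply: tsh; rewrite in_cons uts orbT.
have [s [P [P1 P2 P3]]] := cartan_eigenprojections ht.
have PC u c y : u \in h -> P c (br u y) = br u (P c y).
  move=> hu; have Pc z : P c (P c z) = P c z by rewrite (P2 c) ?eqxx.
  have eigu d z : br t (br u (P d z)) = d *: br u (P d z).
    by rewrite (cartan_brCA _ ht hu) P1 -!(adE br_lie) linearZ.
  pose z := y - P c y; have Pz : P c z = 0 by rewrite linearB/= Pc subrr.
  have -> : br u y = br u z + br u (P c y) by rewrite -brDr// subrK.
  rewrite linearD/= [P c (br u (P c y))](P2 c) ?eigu// eqxx.
  suff -> : P c (br u z) = 0 by rewrite add0r.
  rewrite [z]P3 -(adE br_lie) !linear_sum big1// => d _ /=.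
  rewrite (adE br_lie) (P2 d) ?eigu//; case: eqP => // <-.
  by rewrite Pz -(adE br_lie) linear0.
exists [seq P c y | y <- ys, c <- s]; split.
  move=> _ /allpairsP[[y c] [/= yys cs ->]] u.
  rewrite in_cons => /predU1P[->|uts].
    by exists c; rewrite P1.
  have [d yd] := ysP _ yys _ uts; exists d.
  rewrite -PC ?yd ?linearZ//; apply: tsh; by rewrite in_cons uts orbT.
rewrite big_allpairs_dep/= xE; apply: eq_bigr => y _; exact: P3.
Qed.

Lemma joint_eigenvector_weight y :
  (forall t : g, t \in vbasis h -> exists c, br t y = c *: y) ->
  exists w, root_space br w y.
Proof.
move=> yP.
have /choice[c cP] : forall i : 'I_(\dim h),
    exists c : R[i], br (vbasis h)`_i y = c *: y.
  by move=> i; apply: yP; rewrite mem_nth// size_tuple.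
pose f (t : subvs_of h) : R[i]^o := \sum_i coord (vbasis h) i (vsval t) * c i.
have flin : linear f.
  move=> a t t'; rewrite scaler_sumr -big_split; apply: eq_bigr => i _ /=.
  by rewrite !linearP/= mulrDl -mulrA.
exists (linfun f) => t; rewrite linfunE// {1}(coord_vbasis (subvsP t)).
rewrite -(linfunE (br_linear_l br_lie y)) linear_sum scaler_suml.
apply: eq_bigr => i _.
by rewrite linearZ/= linfunE; [rewrite cP scalerA|exact: br_linear_l].
Qed.

Lemma weight_decomposition x : exists s : seq (dual h * g),
  (forall q, q \in s -> root_space br q.1 q.2 /\ q.2 != 0) /\
  x = \sum_(q <- s) q.2.
Proof.
have [|ys [ysP xE]] := @joint_eigenvectors (vbasis h) _ x.
  by move=> t; exact: vbasis_mem.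
have /choice[w wP] : forall y, exists w, y \in ys -> root_space br w y.
  move=> y; have [yys|] := boolP (y \in ys); last by exists 0.
  by have [w yw] := joint_eigenvector_weight (ysP _ yys); exists w.
exists [seq (w y, y) | y <- ys & y != 0]; split.
  move=> _ /mapP[y + ->] /=; rewrite mem_filter => /andP[y0 yys].
  by split=> //; exact: wP.
rewrite big_map big_filter xE [RHS]big_mkcond/=; apply: eq_bigr => y _.
by case: eqP.
Qed.

Lemma root_space0 x : root_space br (0 : dual h) x -> x \in h.
Proof.
by move=> x0; apply: cartan_maximal => t; rewrite x0 zero_lfunE scale0r.
Qed.

Lemma nonzero_weight w x : root_space br w x -> x != 0 -> w = 0 \/ is_root br w.
Proof.
by move=> wx x0; have [->|w0] := eqVneq w 0; [left|right; split=> //; exists x].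
Qed.

End Weights.

(** * Nondegeneracy of the Killing form and the root lattice *)

Section Nondegenerate.
Variables (R : realType) (g : vectType R[i]) (br : g -> g -> g).
Hypothesis br_lie : lie_bracket br.
Hypothesis br_simple : simple_lie_algebra br.
Notation K := (killing br).

(** The radical of the Killing form is an ideal, by invariance. *)
Lemma killing_nondegenerate : (exists x y, K x y != 0) ->
  forall x, (forall y, K x y = 0) -> x = 0.
Proof.
move=> [x0 [y0 Kxy]] x Kx.
pose b := vbasis (fullv : {vspace g}).
pose f (z : g) : 'rV[R[i]]_(\dim (fullv : {vspace g})) := \row_i K z b`_i.
have flin : linear f.
  by move=> a u v; apply/rowP => i; rewrite !mxE killing_linear_l.
pose I := lker (linfun f).
have IP z : reflect (forall y, K z y = 0) (z \in I).
  rewrite memv_ker linfunE//; apply: (iffP eqP) => [fz y|Kz]; last first.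
    by apply/rowP => i; rewrite !mxE Kz.
  rewrite (coord_vbasis (memvf y)) killing_sym.
  rewrite (big_morph (K^~ z) (fun u v => killingDl br_lie u v z)
    (killing0l br_lie z)).
  rewrite big1// => i _; rewrite (killingZl br_lie) killing_sym.
  by have /rowP/(_ i) := fz; rewrite !mxE => ->; rewrite mulr0.
have idealI : lie_ideal br I.
  move=> u v /IP Kv; apply/IP => w.
  by rewrite br_antisym// -scaleN1r killingZl// killing_invariant// Kv mulr0.
have [I0|If] := br_simple.2 I idealI.
  by apply/eqP; rewrite -memv0 -I0; apply/IP.
have /IP/(_ y0) Kxy0 : x0 \in I by rewrite If memvf.
by rewrite Kxy0 eqxx in Kxy.
Qed.

(** By invariance K([t, x], y) = - K(x, [t, y]), so c K(x, y) = - d K(x, y). *)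
Lemma killing_eigen_orthogonal t c d x y :
  br t x = c *: x -> br t y = d *: y -> c + d != 0 -> K x y = 0.
Proof.
move=> tx ty cd; have := killing_invariant br_lie x t y.
rewrite (br_antisym br_lie) tx ty -scaleNr killingZl//.
rewrite [K x (d *: y)]killing_sym killingZl//.
rewrite [K y x]killing_sym => /eqP; rewrite -subr_eq0 -mulrBl mulf_eq0.
by rewrite -opprD oppr_eq0 (negPf cd) => /eqP.
Qed.

End Nondegenerate.

Section Roots.
Variables (R : realType) (g : vectType R[i]) (br : g -> g -> g) (h : {vspace g}).
Variables (n : nat) (Gamma : n.-tuple (dual h)).
Hypothesis br_lie : lie_bracket br.
Hypothesis h_cartan : cartan_subalgebra br h.
Hypothesis Gamma_simple : simple_roots br Gamma.
Notation K := (killing br).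
Implicit Types (w : dual h) (t : subvs_of h).

Lemma dual_evalE w t :
  (w t : R[i]) = \sum_i coord Gamma i w * (tnth Gamma i t : R[i]).
Proof.
case: Gamma_simple => bG _ _.
rewrite {1}(coord_basis bG (memvf w)) sum_lfunE; apply: eq_bigr => i _.
by rewrite scale_lfunE (tnth_nth 0).
Qed.

(** The simple roots form a basis of the dual, so they are coordinates on h. *)
Lemma dual_basis_point (v : 'I_n -> R[i]) :
  exists t, forall i, (tnth Gamma i t : R[i]) = v i.
Proof.
case: (Gamma_simple) => bG _ _.
pose f t : 'rV[R[i]]_n := \row_i (tnth Gamma i t : R[i]).
have flin : linear f by move=> a u w; apply/rowP => i; rewrite !mxE linearP.
have f_inj : lker (linfun f) == 0%VS.
  rewrite -subv0; apply/subvP => t; rewrite memv_ker linfunE// => /eqP ft.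
  have t0 w : (w t : R[i]) = 0.
    rewrite dual_evalE big1// => i _.
    by have /rowP/(_ i) := ft; rewrite !mxE => ->; rewrite mulr0.
  rewrite memv0 (coord_vbasis (memvf t)); apply/eqP; apply: big1 => i _.
  have := t0 (linfun (coord (vbasis fullv) i : _ -> R[i]^o)).
  by rewrite linfunE => [->|a u w]; [rewrite scale0r|rewrite linearP].
have dimh : \dim (fullv : {vspace subvs_of h}) = n.
  rewrite -(size_basis bG) [RHS]dimvf dimvf.
  by apply/esym; exact: muln1.
have fT : (linfun f @: fullv)%VS = fullv.
  apply/eqP; rewrite eqEdim subvf limg_dim_eq ?dimh; last first.
    by rewrite (eqP f_inj) capv0.
  by rewrite dimvf dim_matrix mul1r leqnn.
have : \row_i v i \in (linfun f @: fullv)%VS by rewrite fT memvf.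
move=> /memv_imgP[t _]; rewrite linfunE// => /rowP vt; exists t => i.
by have := vt i; rewrite !mxE.
Qed.

Lemma root_coord_int w i : is_root br w ->
  exists m : int, coord Gamma i w = m%:~R.
Proof.
case: Gamma_simple => _ _ rootP /rootP[[_ /(_ i)[m ->]]|[_ /(_ i)[m ->]]].
  by exists m%:Z.
by exists (- m%:Z); rewrite mulrNz.
Qed.

Lemma eigenvector_decomposition t (c : R[i]) x : br (vsval t) x = c *: x ->
  exists s : seq (dual h * g),
    (forall q, q \in s ->
      [/\ root_space br q.1 q.2, q.2 != 0 & (q.1 t : R[i]) = c]) /\
    x = \sum_(q <- s) q.2.
Proof.
move=> tx; have [s [sP xE]] := weight_decomposition br_lie h_cartan x.
have [cs [P [P1 P2 P3]]] := cartan_eigenprojections br_lie h_cartan (subvsP t).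
exists [seq q : dual h * g <- s | (q.1 t : R[i]) == c]; split.
  by move=> q; rewrite mem_filter => /andP[/eqP qc /sP[? ?]].
have <- : P c x = x by rewrite (P2 c) ?eqxx.
rewrite xE linear_sum big_filter [RHS]big_mkcond/=.
apply: eq_big_seq => q /sP[q1 _].
by rewrite (P2 (q.1 t)) ?q1// eq_sym.
Qed.

Lemma eigenvalue_int t (c : R[i]) x :
  (forall i, exists m : int, (tnth Gamma i t : R[i]) = m%:~R) ->
  br (vsval t) x = c *: x -> x != 0 -> exists m : int, c = m%:~R.
Proof.
move=> tint tx x0; have [[|q s] [sP xE]] := eigenvector_decomposition tx.
  by rewrite xE big_nil eqxx in x0.
have [qw q0 <-] := sP q (mem_head _ _).
have [->|qr] := nonzero_weight qw q0; first by exists 0; rewrite zero_lfunE.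
rewrite dual_evalE.
apply: (big_ind (fun c : R[i] => exists m : int, c = m%:~R)).
- by exists 0.
- by move=> _ _ [a ->] [b ->]; exists (a + b); rewrite intrD.
- move=> i _; have [a ->] := root_coord_int i qr; have [b ->] := tint i.
  by exists (a * b); rewrite intrM.
Qed.

(** At the point t where all simple roots are 1, every eigenvalue of ad t is an
    integer, so K(t, t) is a sum of squares.  If it were 0, then ad t would
    vanish, but it acts by 1 on the root space of a simple root.  The index [j]
    provides a simple root. *)
Lemma killing_neq0 (j : 'I_n) : exists x y, K x y != 0.
Proof.
have [t tE] := dual_basis_point (fun=> 1).
exists (vsval t), (vsval t); apply/eqP => Kt.
case: (h_cartan) => _ _ /(_ _ (subvsP t))[b bb eig].
have sb : size b == \dim (fullv : {vspace g}).
  by rewrite -(size_basis (X := in_tuple b) bb).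
pose e := Tuple sb; have be : basis_of fullv e by [].
have /choice[c cE] : forall i : 'I_(\dim (fullv : {vspace g})),
    exists m : int, br (vsval t) e`_i = m%:~R *: e`_i.
  move=> i; have ei : e`_i \in b by rewrite mem_nth// (eqP sb).
  have [c te] := eig _ ei.
  have [|m cm] := eigenvalue_int _ te (basis_not0 bb ei).
    by move=> l; exists 1; rewrite tE.
  by exists m; rewrite -cm.
have KtE : K (vsval t) (vsval t) = \sum_i ((c i)%:~R ^+ 2 : R[i]).
  rewrite /killing (trace_mxof_basis _ (vbasisP _) be).
  apply: trace_eigenbasis => // i.
  by rewrite comp_lfunE !adE// cE -(adE br_lie) linearZ/= adE// cE scalerA expr2.
have c0 i : c i = 0.
  move: Kt; rewrite KtE => /psumr_eq0P/(_ i isT) => cc; apply/eqP.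
  rewrite -(intr_eq0 R[i]) -sqrf_eq0; apply/eqP/cc => l _.
  by rewrite -rmorphXn/= ler0z sqr_ge0.
have [_ /(_ j)[_ [x xj x0]] _] := Gamma_simple.
have : br (vsval t) x = 0.
  rewrite (coord_basis be (memvf x)) -(adE br_lie) linear_sum big1// => i _.
  by rewrite linearZ/= adE// cE c0 scale0r scaler0.
by rewrite xj tE scale1r => xE; rewrite xE eqxx in x0.
Qed.

End Roots.

(** * The grading by the coefficient of a simple root *)

Section Grading.
Variables (R : realType) (g : vectType R[i]) (br : g -> g -> g).

(** The projections are indexed by all integers, so that degrees can be added
    freely; [grading_sum] lists the degrees from -k to k by shifting. *)
Record lie_grading (k : nat) (p : int -> 'End(g)) : Prop := LieGrading {
  grading_proj : forall r s x, p r (p s x) = if r == s then p s x else 0;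
  grading_bound : forall r x, (k < `|r|)%N -> p r x = 0;
  grading_sum : forall x, x = \sum_(i < k.*2.+1) p (i%:Z - k%:Z) x;
  grading_br : forall r s x y,
    p r x = x -> p s y = y -> p (r + s) (br x y) = br x y }.

End Grading.

Section RootGrading.
Variables (R : realType) (g : vectType R[i]) (br : g -> g -> g) (h : {vspace g}).
Variables (n : nat) (Gamma : n.-tuple (dual h)) (amax : dual h) (j : 'I_n).
Hypothesis br_lie : lie_bracket br.
Hypothesis br_simple : simple_lie_algebra br.
Hypothesis h_cartan : cartan_subalgebra br h.
Hypothesis Gamma_simple : simple_roots br Gamma.
Hypothesis amax_max : maximal_root br Gamma amax.
Notation K := (killing br).

Lemma coord_Gamma i l : coord Gamma i (tnth Gamma l) = (i == l)%:R.
Proof.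
case: Gamma_simple => bG _ _.
by rewrite (tnth_nth 0) coord_free ?(basis_free bG)// eq_sym.
Qed.

(** The simple root number [j] has coefficient 1 at itself, so maximality gives
    at least 1. *)
Lemma maximal_root_coord_nat :
  exists2 k : nat, coord Gamma j amax = k%:R & (0 < k)%N.
Proof.
case: amax_max Gamma_simple => am amx [_ Groot rootP].
have ge1 : (1 : R[i]) <= coord Gamma j amax.
  by have := amx _ j (Groot j); rewrite coord_Gamma eqxx.
case: (rootP _ am) => -[_ /(_ j)[k kE]]; rewrite kE in ge1.
  by exists k => //; move: ge1; rewrite ler1n.
have : (1 : R[i]) <= 0 by apply: le_trans ge1 _; rewrite oppr_le0 ler0n.
by rewrite ler10.
Qed.

(** Degrees above k are excluded by the maximal root.  Degrees below -k are
    excluded by nondegeneracy of the Killing form: a vector of degree r pairs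
    only with vectors of degree - r. *)
Lemma root_grading : exists (t : subvs_of h) (p : int -> 'End(g)),
  [/\ forall i, (tnth Gamma i t : R[i]) = (i == j)%:R,
      forall r x, br (vsval t) (p r x) = r%:~R *: p r x,
      forall r s x, br (vsval t) x = s%:~R *: x ->
        p r x = if r == s then x else 0
    & forall k, coord Gamma j amax = k%:R -> lie_grading br k p].
Proof.
have [t tE] := dual_basis_point Gamma_simple (fun i => (i == j)%:R : R[i]).
have [cs [P [P1 P2 P3]]] := cartan_eigenprojections br_lie h_cartan (subvsP t).
have Pid r s x : br (vsval t) x = s%:~R *: x ->
    P r%:~R x = if r == s :> int then x else 0.
  by move=> tx; rewrite (P2 _ _ _ tx) eqr_int.
exists t, (fun r => P r%:~R); split=> // k kE.
have Pint c x : P c x != 0 -> exists2 m : int, c = m%:~R & m <= k%:Z.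
  move=> Px0; have := P1 c x; move: (P c x) Px0 => y y0 ty.
  have [[|q s] [sP yE]] := eigenvector_decomposition br_lie h_cartan ty.
    by rewrite yE big_nil eqxx in y0.
  have [qw q0 qc] := sP q (mem_head _ _).
  have [q10|qr] := nonzero_weight qw q0.
    by exists 0 => //; rewrite -qc q10 zero_lfunE.
  have [m mE] := root_coord_int Gamma_simple j qr; exists m.
    rewrite -qc (dual_evalE Gamma_simple) (bigD1 j)//= tE eqxx mulr1 mE.
    rewrite big1 ?addr0//.
    by move=> i /negPf ij; rewrite tE ij mulr0.
  have := amax_max.2 _ j qr.
  by rewrite mE kE (_ : k%:R = (k%:Z)%:~R :> R[i])// ler_int.
have nd := killing_nondegenerate br_lie br_simple
  (killing_neq0 br_lie h_cartan Gamma_simple j).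
have Pbound (r : int) x : (k < `|r|)%N -> P r%:~R x = 0.
  move=> kr; apply/eqP; apply: contraT => Px0.
  have [m /eqP] := Pint _ _ Px0; rewrite eqr_int => /eqP <- rk.
  case/eqP: Px0; apply: nd => y; rewrite killing_sym (P3 y).
  rewrite (big_morph (K^~ _) (fun u v => killingDl br_lie u v _)
    (killing0l br_lie _)).
  rewrite big1// => c _; have [->|Py0] := eqVneq (P c y) 0.
    exact: killing0l.
  have [l cl lk] := Pint _ _ Py0.
  apply: (killing_eigen_orthogonal br_lie (P1 _ _) (P1 _ _)).
  by rewrite cl -intrD intr_eq0; lia.
split=> //.
- by move=> r s x; exact: Pid.
- move=> x; apply/eqP; rewrite -subr_eq0; apply/eqP.
  set y := x - _; rewrite (P3 y); apply: big1 => c _; apply/eqP/contraT => Py0.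
  have [m cm mk] := Pint _ _ Py0.
  case/eqP: Py0; rewrite cm linearB/= linear_sum/=.
  have [km|km] := ltnP k `|m|.
    by rewrite Pbound// big1 ?subrr// => i _; exact: Pbound.
  have ml : (`|(m + k%:Z)%R| < k.*2.+1)%N by lia.
  rewrite (bigD1 (Ordinal ml))//= big1 ?addr0.
    have -> : (`|(m + k%:Z)%R|%N%:Z - k%:Z) = m by lia.
    by rewrite (Pid _ _ _ (P1 _ _)) eqxx subrr.
  move=> i im; rewrite (Pid _ _ _ (P1 _ _)) ifF//; apply/negP => /eqP mi.
  by case/eqP: im; apply: val_inj => /=; lia.
- move=> r s x y px py.
  have tx : br (vsval t) x = r%:~R *: x by rewrite -px P1.
  have ty : br (vsval t) y = s%:~R *: y by rewrite -py P1.
  rewrite (Pid _ (r + s) (br x y)) ?eqxx//.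
  have := ad_br br_lie (vsval t) x y => /eqP; rewrite eq_sym subr_eq => /eqP ->.
  rewrite tx ty -!(adE br_lie) linearZ/= !adE// intrD scalerDl; congr (_ + _).
  rewrite -(linfunE (br_linear_l br_lie y)) linearZ/= linfunE//.
  exact: br_linear_l.
Qed.

End RootGrading.

Section SumFamily.
Variables (F : fieldType) (V : lmodType F) (I : choiceType).
Variables (D : set I) (S : I -> set V).
Hypothesis S0 : forall i, S i 0.
Hypothesis SD : forall i x y, S i x -> S i y -> S i (x + y).

Lemma sum_family_ind (P : V -> Prop) :
  P 0 -> (forall x y, P x -> P y -> P (x + y)) ->
  (forall i x, D i -> S i x -> P x) -> forall x, sum_family D S x -> P x.
Proof.
move=> P0 PD PS _ [f fS ->]; rewrite big_seq_cond; apply: big_ind => // i.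
rewrite andbT; case: finite_supportP => //= X XD _ _ /XD Di.
by apply: (PS i); [|apply: fS].
Qed.

Lemma sum_family0 : sum_family D S 0.
Proof. by exists (fun=> 0) => //; rewrite fsbig1. Qed.

Lemma sum_family1 i x : D i -> S i x -> sum_family D S x.
Proof.
move=> Di Sx; exists (fun l => if l == i then x else 0).
  by move=> l _; case: eqP => [->|].
rewrite -(@fsbig_widen _ _ _ _ [set i] D) ?fsbig_set1 ?eqxx//.
  by move=> _ ->.
by move=> l [_ /= /eqP/negPf ->].
Qed.

(** A sum with infinite support is 0 by convention, so such a family can be
    replaced by the zero family; this makes [sum_family] closed under addition
    even when the index set is infinite. *)
Lemma sum_family_finite x : sum_family D S x ->
  exists f : I -> V, [/\ finite_set (f @^-1` [set~ 0]),
    forall i, D i -> S i (f i), forall i, ~ D i -> f i = 0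
    & x = \sum_(i \in [set: I]) f i].
Proof.
move=> [f fS ->]; rewrite fsbig_mkcond; set f' := patch _ _ _.
have [fin|inf] := pselect (finite_set (f' @^-1` [set~ 0])).
  exists f'; split=> // i.
    by rewrite /f' /patch => Di; rewrite mem_set//; exact: fS.
  by rewrite /f' /patch => Di; rewrite memNset.
exists (fun=> 0); split=> //; last by rewrite fsbig_dflt ?fsbig1// setTI.
by rewrite (_ : _ @^-1` _ = set0)// -subset0 => i /=.
Qed.

Lemma sum_familyD x y :
  sum_family D S x -> sum_family D S y -> sum_family D S (x + y).
Proof.
move=> /sum_family_finite[f [ffin fS f0 ->]].
move=> /sum_family_finite[e [efin eS e0 ->]].
rewrite -fsumD//; exists (fun i => f i + e i).
  by move=> i Di; apply: SD; [exact: fS|exact: eS].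
by apply/esym/fsbig_widen => // i [_ Di] /=; rewrite f0// e0// addr0.
Qed.

End SumFamily.

(** * Specialization of loops *)

Section Loop.
Variables (R : realType) (g : vectType R[i]) (br : g -> g -> g).
Variables (k : nat) (p : int -> 'End(g)).
Notation K := (killing br).
Hypothesis br_lie : lie_bracket br.
Hypothesis k_gt0 : (0 < k)%N.
Hypothesis gr : lie_grading br k p.
Hypothesis K_graded :
  forall r s x y, p r x = x -> p s y = y -> r + s != 0 -> K x y = 0.
Hypothesis K_nondeg : forall x, (forall y, K x y = 0) -> x = 0.

Let brDl := brDl br_lie.
Let brDr := brDr br_lie.
Let KDl := killingDl br_lie.
Let KDr := killingDr br_lie.
Let pp := grading_proj gr.
Let pid r x : p r (p r x) = p r x.
Proof. by rewrite pp eqxx. Qed.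

Lemma grading_eq0 x : (forall r, p r x = 0) -> x = 0.
Proof. by move=> px; rewrite (grading_sum gr x) big1// => i _; exact: px. Qed.

Lemma homogP r x : p r x = x <-> forall s, s != r -> p s x = 0.
Proof.
split=> [<- s sr|px]; first by rewrite pp (negPf sr).
apply/eqP; rewrite -subr_eq0; apply/eqP/grading_eq0 => s.
rewrite linearB/= pp; have [->|/px ->] := eqVneq s r; first by rewrite subrr.
by rewrite subr0.
Qed.

(** The total degree of x u^n, for x of degree r, is k n + r; it is additive
    for the loop bracket, and here it is nonpositive on every component. *)
Definition maximal_loops : set (int -> g) :=
  [set f | laurent g f /\
     forall n r : int, 0 < k%:Z * n + r -> p r (f n) = 0].
Notation A := maximal_loops.

Definition eval1 (f : int -> g) : g := \sum_(n \in [set: int]) f n.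

(** The part of total degree 0 of an element of A: since the degrees lie between -k
    and k, it involves only the powers u, 1 and u^-1.  Dropping these powers of
    u identifies it with an element of L_alpha. *)
Definition degree0 (f : int -> g) : g :=
  p (- k%:Z) (f 1) + p 0 (f 0) + p k (f (-1)).

Definition loop_specialization (f : int -> g) : g * g := (degree0 f, eval1 f).
Notation phi := loop_specialization.

Definition top_zero_bottom : set g :=
  [set x | p (- k%:Z) x + p 0 x + p k x = x].

Definition glued_parabolics : set (g * g) :=
  [set q | [/\ forall r, r != 0 -> r != - k%:Z -> p r q.1 = 0,
               forall r, 0 < r -> p r q.2 = 0 & p 0 q.1 = p 0 q.2]].

Lemma maximal_loops_gt1 f n : A f -> 1 < n -> f n = 0.
Proof.
move=> [_ Af] n1; apply: grading_eq0 => r.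
have [rk|rk] := ltnP k `|r|; first exact: (grading_bound gr).
apply: Af; nia.
Qed.

Lemma maximal_loops_linear a f1 f2 : A f1 -> A f2 -> A (a *: f1 + f2).
Proof.
move=> [l1 h1] [l2 h2]; split.
  apply: laurentD => //; move: l1 => [N h]; exists N => n nN.
  by rewrite fctE h// scaler0.
by move=> n r nr; rewrite !fctE linearD linearZ/= h1// h2// scaler0 addr0.
Qed.

Lemma maximal_loops0 : A 0.
Proof. by split=> [|n r _]; [exists 0|rewrite linear0]. Qed.

Lemma maximal_loopsD f1 f2 : A f1 -> A f2 -> A (f1 + f2).
Proof. by move=> *; rewrite -[f1]scale1r; exact: maximal_loops_linear. Qed.

Lemma maximal_loops_monomial n r x : p r x = x -> k%:Z * n + r <= 0 ->
  A (monomial n x).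
Proof.
move=> px nr; split; first exact: laurent_monomial.
move=> m s ms; rewrite /monomial; case: eqP => [mn|_]; last by rewrite linear0.
by apply/(homogP r x).1 => //; lia.
Qed.

(** An element of A is a finite sum of homogeneous monomials, so additive
    statements about A need only be checked on monomials. *)
Lemma maximal_loops_ind (P : (int -> g) -> Prop) :
  P 0 -> (forall f1 f2, A f1 -> A f2 -> P f1 -> P f2 -> P (f1 + f2)) ->
  (forall n r x, p r x = x -> k%:Z * n + r <= 0 -> P (monomial n x)) ->
  forall f, A f -> P f.
Proof.
move=> P0 PD Pm f Af; have [[M fM] fr] := Af.
(* A bound N <= 2 makes `|2 - N| the number of exponents from N to 1. *)
have [N [N0 fN]] : exists N : int, N <= 0 /\ forall n, n < N -> f n = 0.
  by exists (Num.min M 0); split=> [|n nN]; [|apply: fM]; lia.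
pose h (i : 'I_(`|2 - N|%N)) (j : 'I_k.*2.+1) : int -> g :=
  monomial (N + i%:Z) (p (j%:Z - k%:Z) (f (N + i%:Z))).
have APh i j : A (h i j) /\ P (h i j).
  have [le0|gt0] := lerP (k%:Z * (N + i%:Z) + (j%:Z - k%:Z)) 0.
    by split; [apply: maximal_loops_monomial le0|apply: Pm le0]; exact: pid.
  suff -> : h i j = 0 by split => //; exact: maximal_loops0.
  by apply/funext => l; rewrite /h fr// /monomial; case: eqP.
have -> : f = \sum_i \sum_j h i j.
  apply/funext => l; rewrite !fct_sumE.
  under eq_bigr do rewrite fct_sumE /h /monomial.
  have [lN|Nl] := ltP l N.
    rewrite fN// big1// => i _; rewrite big1// => j _.
    by case: eqP => // lE; lia.
  have [l2|l2] := leP 2 l.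
    rewrite maximal_loops_gt1//.
    rewrite big1// => i _; rewrite big1// => j _.
    by case: eqP => // lE; have := ltn_ord i; lia.
  have li : (`|l - N| < `|2 - N|)%N by lia.
  have lE : l = N + (Ordinal li)%:Z by rewrite /=; lia.
  rewrite (bigD1 (Ordinal li))// [X in _ = _ + X]big1 ?addr0; last first.
    move=> i ii; rewrite big1// => j _; case: eqP => // lEi.
    by case/eqP: ii; apply: val_inj => /=; lia.
  by rewrite -lE eqxx -(grading_sum gr).
suff [] : A (\sum_i \sum_j h i j) /\ P (\sum_i \sum_j h i j) by [].
apply: (big_ind (fun F => A F /\ P F)) => [|F G [AF PF] [AG PG]|i _].
- by split => //; exact: maximal_loops0.
- by split; [exact: maximal_loopsD|exact: PD].
apply: (big_ind (fun F => A F /\ P F)) => [|F G [AF PF] [AG PG]|//].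
- by split => //; exact: maximal_loops0.
- by split; [exact: maximal_loopsD|exact: PD].
Qed.

Lemma maximal_loops_bracket f1 f2 : A f1 -> A f2 -> A (loop_bracket br f1 f2).
Proof.
move=> Af1 Af2; elim/maximal_loops_ind: f1 / Af1 => [|f f' Af Af' h h'|m r x px mr].
- by rewrite /loop_bracket cauchy0l//; exact: maximal_loops0.
- rewrite /loop_bracket cauchyDl//; [exact: maximal_loopsD| | |].
  + by case: Af.
  + by case: Af'.
  + by case: Af2.
elim/maximal_loops_ind: f2 / Af2 => [|f f' Af Af' h h'|n s y py ns].
- by rewrite /loop_bracket cauchy0r//; exact: maximal_loops0.
- rewrite /loop_bracket cauchyDr//; [exact: maximal_loopsD| | |].
  + exact: laurent_monomial.
  + by case: Af.
  + by case: Af'.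
rewrite /loop_bracket cauchy_monomial//.
by apply: (@maximal_loops_monomial _ (r + s)); [exact: (grading_br gr)|lia].
Qed.

Lemma maximal_loops_support f : A f -> finite_set (f @^-1` [set~ 0]).
Proof.
move=> Af; have [[N fN] _] := Af.
by apply: (@finite_support_itv _ _ N 1) => // i; exact: maximal_loops_gt1.
Qed.

Lemma loop_specialization_linear a f1 f2 : A f1 -> A f2 ->
  phi (a *: f1 + f2) = a *: phi f1 + phi f2.
Proof.
move=> A1 A2; congr (_, _).
  rewrite /= /degree0 !fctE !linearP/= !scalerDr [RHS]addrACA.
  by congr (_ + _); rewrite addrACA.
rewrite /= /eval1 -fsumZ -fsumD//; last exact: maximal_loops_support.
have := @maximal_loops_linear a f1 0 A1 maximal_loops0.
by rewrite addr0 => /maximal_loops_support.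
Qed.

Lemma eval1_monomial n x : eval1 (monomial n x) = x.
Proof.
rewrite /eval1 (fsum1 (a := n)) /monomial ?eqxx// => i.
by move=> /negPf ->.
Qed.

Lemma loop_specialization_monomial n r x :
  p r x = x -> k%:Z * n + r <= 0 ->
  phi (monomial n x) = ((if k%:Z * n + r == 0 then x else 0), x).
Proof.
move=> px nr; rewrite /phi eval1_monomial; congr (_, _).
have ps s : p s x = if s == r then x else 0.
  by rewrite -px pp; case: eqP => // <-.
have [rk|rk] := ltnP k `|r|.
  have x0 : x = 0 by rewrite -px (grading_bound gr).
  rewrite /degree0 /monomial x0 !if_same.
  by rewrite !linear0 !addr0.
rewrite /degree0 /monomial.
have [n1|n1] := eqVneq n 1.
  by rewrite n1 /= !linear0 !addr0 ps; congr (if _ then _ else _); lia.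
have [n0|n0] := eqVneq n 0.
  by rewrite n0 /= !linear0 addr0 add0r ps; congr (if _ then _ else _); lia.
have [nN|nN] := eqVneq n (-1).
  by rewrite nN /= !linear0 !add0r ps; congr (if _ then _ else _); lia.
have -> : (k%:Z * n + r == 0) = false by nia.
by rewrite !linear0 !addr0.
Qed.


Lemma loop_specializationD f1 f2 : A f1 -> A f2 ->
  phi (f1 + f2) = phi f1 + phi f2.
Proof.
by move=> *; rewrite -[f1 in LHS]scale1r loop_specialization_linear// scale1r.
Qed.

Lemma loop_specialization0 : phi 0 = 0.
Proof.
congr (_, _); first by rewrite /= /degree0 !linear0 !addr0.
by rewrite /= /eval1 fsbig1.
Qed.

Lemma pair_bracketDl x y z :
  pair_bracket br (x + y) z = pair_bracket br x z + pair_bracket br y z.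
Proof. by rewrite /pair_bracket !brDl. Qed.

Lemma pair_bracketDr x y z :
  pair_bracket br x (y + z) = pair_bracket br x y + pair_bracket br x z.
Proof. by rewrite /pair_bracket !brDr. Qed.

Lemma loop_specialization_bracket f1 f2 : A f1 -> A f2 ->
  phi (loop_bracket br f1 f2) = pair_bracket br (phi f1) (phi f2).
Proof.
rewrite /loop_bracket => Af1 Af2.
elim/maximal_loops_ind: f1 / Af1 => [|f f' Af Af' h h'|m r x px mr].
- rewrite cauchy0l// loop_specialization0.
  by rewrite (biadd0l pair_bracketDl).
- have [l l' l2] : [/\ laurent g f, laurent g f' & laurent g f2].
    by case: Af Af' Af2 => ? _ [? _] [].
  rewrite cauchyDl// !loop_specializationD// ?pair_bracketDl ?h ?h'//.
    exact: (maximal_loops_bracket Af Af2).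
  exact: (maximal_loops_bracket Af' Af2).
have Am := maximal_loops_monomial px mr.
elim/maximal_loops_ind: f2 / Af2 => [|f f' Af Af' h h'|n s y py ns].
- rewrite cauchy0r// loop_specialization0.
  by rewrite (biadd0r pair_bracketDr).
- have [l l' l2] : [/\ laurent g f, laurent g f' & laurent g (monomial m x)].
    by case: Af Af' Am => ? _ [? _] [].
  rewrite cauchyDr// !loop_specializationD// ?pair_bracketDr ?h ?h'//.
    exact: (maximal_loops_bracket Am Af).
  exact: (maximal_loops_bracket Am Af').
have mnrs : k%:Z * (m + n) + (r + s) <= 0 by lia.
rewrite cauchy_monomial// (loop_specialization_monomial (grading_br gr px py) mnrs).
rewrite (loop_specialization_monomial px mr) (loop_specialization_monomial py ns).
congr (_, _) => /=.
have [mr0|mr0] := eqVneq (k%:Z * m + r) 0; last first.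
  by rewrite (biadd0l brDl) ifF//; lia.
have [ns0|ns0] := eqVneq (k%:Z * n + s) 0; last first.
  by rewrite (biadd0r brDr) ifF//; lia.
by rewrite ifT//; lia.
Qed.

Let laurent_a : laurent R[i] (inv_one_minus_u R[i]).
Proof. by exists 0 => n n0; rewrite /inv_one_minus_u leNgt n0. Qed.

Notation Q := (Q_ br (inv_one_minus_u R[i])).

Lemma loop_formDl f1 f2 f : laurent g f1 -> laurent g f2 -> laurent g f ->
  Q (f1 + f2) f = Q f1 f + Q f2 f.
Proof.
move=> l1 l2 l; rewrite /Q_ cauchyDl// cauchyDr//.
- exact: mulrDl.
- exact: mulrDr.
- exact: cauchy_laurent.
- exact: cauchy_laurent.
Qed.

Lemma loop_formDr f1 f2 f : laurent g f1 -> laurent g f2 -> laurent g f ->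
  Q f (f1 + f2) = Q f f1 + Q f f2.
Proof.
move=> l1 l2 l; rewrite /Q_ cauchyDr// cauchyDr//.
- exact: mulrDl.
- exact: mulrDr.
- exact: cauchy_laurent.
- exact: cauchy_laurent.
Qed.

Lemma loop_form0l f : Q 0 f = 0.
Proof. by rewrite /Q_ cauchy0l// cauchy0r//; exact: mulrDr. Qed.

Lemma loop_form0r f : Q f 0 = 0.
Proof. by rewrite /Q_ cauchy0r// cauchy0r//; exact: mulrDr. Qed.

Lemma loop_form_monomial m n x y :
  Q (monomial m x) (monomial n y) = if m + n < 0 then K x y else 0.
Proof.
rewrite /Q_ cauchy_monomial// /residue (cauchy_monomialr (@mulrDr _)).
rewrite /inv_one_minus_u; have -> : (0 <= -1 - (m + n)) = (m + n < 0) by lia.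
by case: ifP; rewrite ?mul1r ?mul0r.
Qed.

Lemma QbarDl x y z : Qbar br (x + y) z = Qbar br x z + Qbar br y z.
Proof. by rewrite /Qbar !KDl opprD addrACA. Qed.

Lemma QbarDr x y z : Qbar br x (y + z) = Qbar br x y + Qbar br x z.
Proof. by rewrite /Qbar !KDr opprD addrACA. Qed.

(** For monomials x u^m and y u^n in A of opposite degrees r and s, m + n <= 0
    with equality exactly when both total degrees are 0; and Q is K(x, y) if
    m + n < 0 and 0 otherwise. *)
Lemma loop_form_specialization f1 f2 : A f1 -> A f2 ->
  Q f1 f2 = - Qbar br (phi f1) (phi f2).
Proof.
move=> Af1 Af2.
elim/maximal_loops_ind: f1 / Af1 => [|f f' Af Af' h h'|m r x px mr].
- by rewrite loop_form0l loop_specialization0 (biadd0l QbarDl) oppr0.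
- have [l l' l2] : [/\ laurent g f, laurent g f' & laurent g f2].
    by case: Af Af' Af2 => ? _ [? _] [].
  by rewrite loop_formDl// loop_specializationD// QbarDl opprD h h'.
have Am := maximal_loops_monomial px mr.
elim/maximal_loops_ind: f2 / Af2 => [|f f' Af Af' h h'|n s y py ns].
- by rewrite loop_form0r loop_specialization0 (biadd0r QbarDr) oppr0.
- have [l l' l2] : [/\ laurent g f, laurent g f' & laurent g (monomial m x)].
    by case: Af Af' Am => ? _ [? _] [].
  by rewrite loop_formDr// loop_specializationD// QbarDr opprD h h'.
rewrite loop_form_monomial (loop_specialization_monomial px mr).
rewrite (loop_specialization_monomial py ns) /Qbar /= opprB.
have [rs|rs] := eqVneq (r + s) 0; last first.
  rewrite (K_graded px py rs) if_same sub0r.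
  by do 2 case: eqP => _;
     rewrite ?(biadd0l KDl) ?(biadd0r KDr) ?(K_graded px py rs) oppr0.
have [mr0|mr0] := eqVneq (k%:Z * m + r) 0; last first.
  by rewrite (biadd0l KDl) subr0 ifT//; nia.
have [ns0|ns0] := eqVneq (k%:Z * n + s) 0; last first.
  by rewrite (biadd0r KDr) subr0 ifT//; nia.
by rewrite subrr ifF//; nia.
Qed.

Lemma killing_homog_eq0 r x w : p r w = w -> p (- r) x = 0 -> K x w = 0.
Proof.
move=> pw px; rewrite (grading_sum gr x).
rewrite (big_morph (fun z => K z w) (fun y z => KDl y z w) (biadd0l KDl w)).
rewrite big1// => i _; have [->|sr] := eqVneq (i%:Z - k%:Z) (- r).
  by rewrite px (biadd0l KDl).
by apply: (K_graded (pid _ x) pw); lia.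
Qed.

Lemma killing_proj_eq0 r x :
  (forall y, p (- r) y = y -> K x y = 0) -> p r x = 0.
Proof.
move=> Kx; apply: K_nondeg => y; rewrite (grading_sum gr y).
rewrite (big_morph _ (KDr (p r x)) (biadd0r KDr (p r x))).
rewrite big1// => i _; have [->|sr] := eqVneq (i%:Z - k%:Z) (- r); last first.
  by apply: (K_graded (pid _ x) (pid _ y)); lia.
have := @killing_homog_eq0 (- r) (x - p r x) _ (pid _ y).
rewrite opprK linearB/= pid subrr => /(_ erefl) Kxp.
have := Kx _ (pid _ y); rewrite -{1}[x](subrK (p r x)) KDl Kxp add0r.
by [].
Qed.

(** Multiplication by 1 - u cancels the factor 1 / (1 - u) of the form, so Q
    pairs f with y u^m directly by the residue. *)
Lemma loop_form_difference f m y : laurent g f ->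
  Q f (monomial m y - monomial (m + 1) y) = K (f (- 1 - m)) y.
Proof.
move=> lf; have lm := @laurent_monomial g.
have lN : laurent g (monomial m y - monomial (m + 1) y).
  apply: laurentD => //; have [N h] := lm (m + 1) y.
  by exists N => n nN; rewrite fctE h// oppr0.
pose d i := K (f (- 1 - i - m)) y.
have QE : Q f (monomial m y) =
    Q f (monomial m y - monomial (m + 1) y) + Q f (monomial (m + 1) y).
  by rewrite -loop_formDr// subrK.
have Qm : Q f (monomial m y) =
    \sum_(i \in [set: int]) inv_one_minus_u R[i] i * d i.
  rewrite /Q_ /residue /cauchy; apply: eq_fsbigr => i _; congr (_ * _).
  exact: (cauchy_monomialr KDr).
have Qm1 : Q f (monomial (m + 1) y) =
    \sum_(i \in [set: int]) inv_one_minus_u R[i] (i - 1) * d i.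
  rewrite /Q_ /residue [LHS](reindex_fsbigT (fun i : int => i - 1)); last first.
    by exists (fun i => i + 1) => i; rewrite ?subrK ?addrK.
  apply: eq_fsbigr => i _; congr (_ * _).
  rewrite (cauchy_monomialr KDr) /d; congr (K (f _) y); lia.
suff Qd : Q f (monomial m y) = d 0 + Q f (monomial (m + 1) y).
  by move: QE; rewrite Qd => /addIr <-; rewrite /d subr0.
have [N fN] := lf.
have fin (c : int -> R[i]) (M : int) : (forall i, i < M -> c i = 0) ->
    finite_set ((fun i => c i * d i) @^-1` [set~ 0]).
  move=> cM; apply: (@finite_support_itv _ _ M (- 1 - m - N)) => i iM.
    by rewrite cM// mul0r.
  by rewrite /d fN ?(biadd0l KDl) ?mulr0//; lia.
(* The coefficients a_i of 1 / (1 - u) satisfy a_i = [i = 0] + a_(i - 1). *)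
rewrite Qm Qm1; have -> : d 0 = \sum_(i \in [set: int]) (i == 0)%:R * d i.
  rewrite (fsum1 (a := 0)) ?mul1r// => i /negPf ->.
  by rewrite mul0r.
rewrite -fsumD; first last.
- by apply: (fin _ 1) => i i1; rewrite /inv_one_minus_u ifF//; lia.
- by apply: (fin (fun i => (i == 0)%:R) 0) => i i0; rewrite lt_eqF.
apply: eq_fsbigr => i _; rewrite -mulrDl; congr (_ * _).
rewrite /inv_one_minus_u.
have [->|i0] := eqVneq i 0; first by rewrite addr0.
have -> : (0 <= i - 1) = (0 <= i) by lia.
by rewrite add0r.
Qed.

(** The kernel of phi contains y u^m - y u^(m + 1) as soon as both monomials
    have negative total degree.  By [loop_form_difference], orthogonality to
    these kills the components of f of positive total degree. *)
Lemma orthogonal_kernel_maximal f : laurent g f ->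
  (forall z, A z -> phi z = 0 -> Q f z = 0) -> A f.
Proof.
move=> lf fO; split=> // n r nr; apply: killing_proj_eq0 => y py.
have mr : k%:Z * (- 1 - n) + - r <= 0 by nia.
have mr1 : k%:Z * (- 1 - n + 1) + - r <= 0 by nia.
have A1 := maximal_loops_monomial py mr.
have A2 := maximal_loops_monomial py mr1.
have := loop_form_difference (- 1 - n) y lf.
have -> : - 1 - (- 1 - n) = n by lia.
move=> <-; apply: fO.
  by rewrite -scaleN1r addrC; exact: maximal_loops_linear.
rewrite -scaleN1r addrC loop_specialization_linear//.
rewrite (loop_specialization_monomial py mr) (loop_specialization_monomial py mr1).
rewrite !ifF; [by rewrite scaleN1r addNr|nia|nia].
Qed.

Let k0 : (k%:Z == 0) = false. Proof. by lia. Qed.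
Let kN0 : (- k%:Z == 0) = false. Proof. by lia. Qed.
Let kNk : (- k%:Z == k%:Z) = false. Proof. by lia. Qed.

Lemma maximal_loops_negative_monomial n x : n < 0 -> A (monomial n x).
Proof.
move=> n0; split; first exact: laurent_monomial.
move=> m r mr; rewrite /monomial; case: eqP => [mn|_]; last by rewrite linear0.
by apply: (grading_bound gr); nia.
Qed.

(** Monomials of total degree 0 produce the component in L_alpha; a multiple of
    u^-2, whose total degrees are negative, then corrects the value at u = 1. *)
Lemma loop_specialization_image : phi @` A = top_zero_bottom `*` setT.
Proof.
apply/seteqP; split=> [_ [f Af <-]|[x y] [/= xL _]].
  split=> //=; rewrite /top_zero_bottom /= /degree0 !linearD/= !pp !eqxx.
  by rewrite ![0 == _]eq_sym ![k%:Z == - _]eq_sym k0 kN0 kNk !(addr0, add0r).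
have Ak : A (monomial (-1) (p k x)) by exact: maximal_loops_negative_monomial.
have A0 : A (monomial 0 (p 0 x)).
  by apply: (maximal_loops_monomial (pid 0 x)); lia.
have A1 : A (monomial 1 (p (- k%:Z) x)).
  by apply: (maximal_loops_monomial (pid _ x)); lia.
have A2 : A (monomial (-2) (y - x)) by exact: maximal_loops_negative_monomial.
exists (monomial 1 (p (- k%:Z) x) + monomial 0 (p 0 x) +
  monomial (-1) (p k x) + monomial (-2) (y - x)).
  by do ! apply: maximal_loopsD.
rewrite !loop_specializationD//; try by do ! apply: maximal_loopsD.
rewrite /phi !eval1_monomial /degree0 /monomial /= !linear0 !pid.
congr (_, _) => /=; first by rewrite !(addr0, add0r).
by rewrite [X in X + _ = _]xL addrC subrK.
Qed.

Lemma laurent_maximal_taylor : laurent g = sum_set A (taylor g).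
Proof.
apply/seteqP; split=> [f lf|_ [f [lf _] [s Ts <-]]]; last first.
  by apply: laurentD => //; exists 0.
exists (fun n => if n < 0 then f n else 0).
  split; first by have [N h] := lf; exists N => n /h ->; rewrite if_same.
  move=> n r nr; case: ifP => n0; last by rewrite linear0.
  by apply: (grading_bound gr); nia.
exists (fun n => if n < 0 then 0 else f n); first by move=> n /= ->.
by apply/funext => n; rewrite fctE; case: ifP; rewrite ?addr0 ?add0r.
Qed.

Lemma eval1_taylor f : A f -> taylor g f -> eval1 f = f 0 + f 1.
Proof.
move=> Af Tf.
have fin n x : finite_set (@monomial g n x @^-1` [set~ 0]).
  by apply: (@finite_support_itv _ _ n n) => i ni; rewrite /monomial ifF//; lia.
have {1}-> : f = monomial 0 (f 0) + monomial 1 (f 1).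
  apply/funext => n; rewrite fctE /monomial.
  have [->|n0] := eqVneq n 0; first by rewrite addr0.
  have [->|n1] := eqVneq n 1; first by rewrite add0r.
  rewrite addr0; have [/Tf //|nN] := ltP n 0.
  by apply: maximal_loops_gt1 => //; lia.
by rewrite /eval1 [LHS]fsumD// -!/(eval1 _) !eval1_monomial.
Qed.

Lemma maximal_loops_taylor_inj f : A f -> taylor g f -> phi f = 0 -> f = 0.
Proof.
move=> Af Tf [d0]; rewrite -/(eval1 f) eval1_taylor// => e1.
have f1 : f 1 = 0.
  apply: grading_eq0 => r; have [->|rk] := eqVneq r (- k%:Z).
    have := congr1 (p (- k%:Z)) d0.
    rewrite linear0 /degree0 !linearD/= !pp eqxx.
    by rewrite kN0 kNk !addr0.
  have [rk'|rk'] := ltnP k `|r|; first exact: (grading_bound gr).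
  by case: Af => _; apply; lia.
have f0 : f 0 = 0 by move: e1; rewrite f1 addr0.
apply/funext => n; have [/Tf //|n0] := ltP n 0.
have [n1|n1] := ltP 1 n; first exact: maximal_loops_gt1.
by have [->|->] : n = 0 \/ n = 1 by lia.
Qed.

Lemma loop_specialization_taylor :
  phi @` (A `&` taylor g) = glued_parabolics.
Proof.
apply/seteqP; split=> [_ [f [Af Tf] <-]|[x y] [/= xr yr xy]].
  have [_ fr] := Af.
  have fN : f (-1) = 0 by exact: Tf.
  have fd : degree0 f = p (- k%:Z) (f 1) + p 0 (f 0).
    by rewrite /degree0 fN linear0 addr0.
  split=> /=; rewrite ?fd ?eval1_taylor//.
  - by move=> r /negPf r0 /negPf rk; rewrite linearD/= !pp r0 rk addr0.
  - by move=> r r0; rewrite linearD/= !fr ?addr0//; lia.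
  - by rewrite !linearD/= !pp eqxx eq_sym kN0 add0r [p 0 (f 1)]fr ?addr0//; lia.
(* The term at u must have the bottom component of x as its value; the one at
   u^0 then makes the value at u = 1 equal to y. *)
set z := p (- k%:Z) x.
have zr r : r != - k%:Z -> p r z = 0 by move=> /negPf rk; rewrite /z pp rk.
pose f : int -> g := monomial 0 (y - z) + monomial 1 z.
have f0 : f 0 = y - z by rewrite /f fctE /monomial /= addr0.
have f1 : f 1 = z by rewrite /f fctE /monomial /= add0r.
have fn n : n != 0 -> n != 1 -> f n = 0.
  by move=> /negPf n0 /negPf n1; rewrite /f fctE /monomial n0 n1 addr0.
have Tf : taylor g f by move=> n n0; apply: fn; lia.
have Af : A f.
  split; first by exists 0.
  move=> n r nr; have [n0|n0] := eqVneq n 0.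
    by rewrite n0 f0 linearB/= yr ?zr ?subr0//; lia.
  have [n1|n1] := eqVneq n 1; first by rewrite n1 f1 zr//; lia.
  by rewrite fn// linear0.
exists f => //; congr (_, _); last by rewrite /= eval1_taylor// f0 f1 subrK.
rewrite /= /degree0 f0 f1 fn// linear0 addr0 linearB/= [p 0 z]zr ?subr0; last by lia.
rewrite -xy /z pid; apply/eqP; rewrite -subr_eq0; apply/eqP/grading_eq0 => r.
rewrite linearB linearD/= !pp.
have [->|rk] := eqVneq r (- k%:Z); first by rewrite kN0 addr0 subrr.
have [->|r0] := eqVneq r 0; first by rewrite add0r subrr.
by rewrite addr0 xr// subrr.
Qed.

Theorem loop_lagrangian_bij :
  set_bij
    [set W | [/\ lagrangian_subalgebra (laurent g) (loop_bracket br) Q W,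
                 transversal_in (laurent g) W (taylor g) & W `<=` A]]
    [set W' | lagrangian_subalgebra (top_zero_bottom `*` setT)
                (pair_bracket br) (Qbar br) W' /\
              transversal_in (top_zero_bottom `*` setT) W' glued_parabolics]
    (fun W => phi @` W).
Proof.
apply: lagrangian_reduction_bij.
- move=> a x y [N h] ly; apply: laurentD => //.
  by exists N => n nN; rewrite fctE h// scaler0.
- exact: maximal_loops_linear.
- exact: maximal_loops0.
- by move=> a x y Tx Ty n n0; rewrite !fctE Tx// Ty// scaler0 addr0.
- by [].
- by move=> f [].
- by move=> f Tf; exists 0.
- exact: maximal_loops_bracket.
- exact: loop_specialization_linear.
- exact: loop_specialization_bracket.
- exact: loop_specialization_image.
- exact: loop_form_specialization.
- exact: (biadd0l QbarDl).
- exact: orthogonal_kernel_maximal.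
- exact: laurent_maximal_taylor.
- exact: loop_specialization_taylor.
- exact: maximal_loops_taylor_inj.
Qed.
End Loop.

(** * Root-theoretic sets in terms of the grading *)

Section TensorSet.
Variables (R : realType) (g : vectType R[i]).
Variables (M : set (int -> R[i])) (S : set g).

Lemma tensor_set0 : tensor_set M S 0.
Proof.
exists 0%N, (fun=> 0), (fun=> 0); split; first by case.
by apply/funext => l; rewrite big_ord0.
Qed.

Lemma tensor_set1 f x : M f -> S x -> tensor_set M S (fun l => f l *: x).
Proof.
move=> Mf Sx; exists 1%N, (fun=> f), (fun=> x); split=> //.
by apply/funext => l; rewrite big_ord1.
Qed.

Lemma tensor_setD F1 F2 :
  tensor_set M S F1 -> tensor_set M S F2 -> tensor_set M S (F1 + F2).
Proof.
move=> [m1 [f1 [x1 [MS1 ->]]]] [m2 [f2 [x2 [MS2 ->]]]].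
exists (m1 + m2)%N,
  (fun i => match fintype.split i with inl l => f1 l | inr l => f2 l end),
  (fun i => match fintype.split i with inl l => x1 l | inr l => x2 l end).
split; first by move=> i; case: fintype.split.
apply/funext => l; rewrite fctE big_split_ord; congr (_ + _); apply: eq_bigr => i _.
  by rewrite (unsplitK (inl i)).
by rewrite (unsplitK (inr i)).
Qed.

End TensorSet.

Section Identification.
Variables (R : realType) (g : vectType R[i]) (br : g -> g -> g) (h : {vspace g}).
Variables (n : nat) (Gamma : n.-tuple (dual h)) (amax : dual h) (j : 'I_n).
Hypothesis br_lie : lie_bracket br.
Hypothesis h_cartan : cartan_subalgebra br h.
Hypothesis Gamma_simple : simple_roots br Gamma.
Variables (t : subvs_of h) (p : int -> 'End(g)) (k : nat).
Hypothesis tE : forall i, (tnth Gamma i t : R[i]) = (i == j)%:R.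
Hypothesis t_proj : forall r x, br (vsval t) (p r x) = r%:~R *: p r x.
Hypothesis proj_eigen : forall r s x,
  br (vsval t) x = s%:~R *: x -> p r x = if r == s then x else 0.
Hypothesis gr : lie_grading br k p.
Hypothesis kE : coord Gamma j amax = k%:R.
Hypothesis k_gt0 : (0 < k)%N.
Implicit Types (w : dual h) (D : set (dual h)) (Q : int -> Prop).

Lemma eval_grading w : (w t : R[i]) = coord Gamma j w.
Proof.
rewrite (dual_evalE Gamma_simple) (bigD1 j)//= tE eqxx mulr1 big1 ?addr0//.
by move=> i /negPf ij; rewrite tE ij mulr0.
Qed.

Lemma root_space_addr0 w : root_space br w 0.
Proof. by move=> s; rewrite scaler0 -(adE br_lie) linear0. Qed.

Lemma root_space_addrD w x y :
  root_space br w x -> root_space br w y -> root_space br w (x + y).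
Proof. by move=> wx wy s; rewrite brDr// wx wy scalerDr. Qed.

Definition degrees Q : set g := [set x | forall r, ~ Q r -> p r x = 0].

Lemma degrees0 Q : degrees Q 0.
Proof. by move=> r _; rewrite linear0. Qed.

Lemma degreesD Q x y : degrees Q x -> degrees Q y -> degrees Q (x + y).
Proof. by move=> Qx Qy r Qr; rewrite linearD/= Qx// Qy// addr0. Qed.

Lemma root_space_degree w (m : int) x r : root_space br w x ->
  coord Gamma j w = m%:~R -> p r x = if r == m then x else 0.
Proof. by move=> wx wm; apply: proj_eigen; rewrite wx eval_grading wm. Qed.

Lemma cartan_degree x r : x \in h -> p r x = if r == 0 then x else 0.
Proof.
by move=> xh; apply: proj_eigen; rewrite scale0r; exact: (cartan_br0 h_cartan (subvsP t)).
Qed.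

(** The set D consists of the roots whose coefficient at alpha satisfies Q; the
    coefficient is an integer seen as a complex number. *)
Definition graded_by D Q := forall w, D w <->
  is_root br w /\ exists2 m : int, coord Gamma j w = m%:~R & Q m.

Lemma root_sum_degrees D Q : graded_by D Q -> root_sum br D `<=` degrees Q.
Proof.
move=> DQ; apply: sum_family_ind => [|x y|w x /DQ[wr [m wm Qm]] wx].
- exact: degrees0.
- exact: degreesD.
by move=> r Qr; rewrite (root_space_degree r wx wm); case: eqP => // rm; rewrite rm in Qr.
Qed.

(** The homogeneous components of a vector split further into weight vectors,
    of weight 0 in h or of weight a root. *)
Lemma degrees_ind Q (P : g -> Prop) :
  P 0 -> (forall x y, P x -> P y -> P (x + y)) ->
  (forall x, x \in h -> Q 0 -> P x) ->
  (forall w m x, is_root br w -> coord Gamma j w = m%:~R -> Q m ->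
     root_space br w x -> P x) ->
  degrees Q `<=` P.
Proof.
move=> P0 PD Ph Pr x Qx; rewrite (grading_sum gr x).
apply: big_ind => // i _; set r := (i%:Z - k%:Z).
have [Qr|/Qx ->//] := pselect (Q r).
have [s [sP ->]] := eigenvector_decomposition br_lie h_cartan (t_proj r x).
rewrite big_seq; apply: big_ind => // q /sP[qw q0 qr].
have [q10|qroot] := nonzero_weight qw q0.
  have r0 : r = 0.
    by move: qr; rewrite q10 zero_lfunE => /eqP; rewrite eq_sym intr_eq0 => /eqP.
  apply: Ph; last by rewrite -r0.
  by apply: (root_space0 br_lie h_cartan); rewrite -q10.
by apply: (Pr q.1 r) => //; rewrite -eval_grading.
Qed.

Lemma root_sumE D Q : graded_by D Q -> ~ Q 0 -> root_sum br D = degrees Q.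
Proof.
move=> DQ Q0; apply/seteqP; split; first exact: root_sum_degrees.
apply: degrees_ind => [|x y|//|w m x wr wm Qm wx].
- exact: sum_family0 root_space_addr0.
- apply: sum_familyD; [exact: root_space_addr0|exact: root_space_addrD].
- apply: (@sum_family1 _ _ _ _ _ _ w) => //; first exact: root_space_addr0.
  by apply/DQ; split=> //; exists m.
Qed.

Lemma cartan_root_sumE D Q : graded_by D Q -> Q 0 ->
  cartan_root_sum br D = degrees Q.
Proof.
move=> DQ Q0; apply/seteqP; split.
  move=> _ [x xh [y yD <-]]; apply: degreesD; last exact: root_sum_degrees yD.
  by move=> r Qr; rewrite cartan_degree//; case: eqP => // r0; rewrite r0 in Qr.
apply: degrees_ind => [|x y|x xh _|w m x wr wm Qm wx].
- exists 0; first exact: mem0v.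
  by exists 0; [exact: sum_family0 root_space_addr0|rewrite addr0].
- move=> [x1 x1h [x2 x2D <-]] [y1 y1h [y2 y2D <-]].
  exists (x1 + y1); first exact: memvD.
  exists (x2 + y2); last by rewrite addrACA.
  by apply: sum_familyD; [exact: root_space_addr0|exact: root_space_addrD|..].
- exists x => //.
  by exists 0; [exact: sum_family0 root_space_addr0|rewrite addr0].
- exists 0; first exact: mem0v.
  exists x; last by rewrite add0r.
  apply: (@sum_family1 _ _ _ _ _ _ w) => //; first exact: root_space_addr0.
  by apply/DQ; split=> //; exists m.
Qed.

Lemma graded_rootsP (r : int) :
  graded_by (graded_roots br Gamma j r%:~R) (eq r).
Proof.
move=> w; split=> [[wr wE]|[wr [m wE rm]]]; first by split=> //; exists r.
by split=> //; rewrite rm.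
Qed.

Lemma g_E (r : int) : g_ br Gamma j r%:~R = degrees (eq r).
Proof.
rewrite /g_ intr_eq0; case: eqP => [->|r0].
  by apply: cartan_root_sumE => //; exact: (graded_rootsP 0).
by apply: root_sumE => //; exact: graded_rootsP.
Qed.

Lemma degrees_homog r x : degrees (eq r) x <-> p r x = x.
Proof.
split=> [rx|/(homogP gr) px s /eqP rs]; last by apply: px; rewrite eq_sym.
by apply/(homogP gr) => s sr; apply: rx => rs; rewrite rs eqxx in sr.
Qed.

Lemma degrees_proj r x : degrees (eq r) (p r x).
Proof. by apply/degrees_homog; rewrite (grading_proj gr) eqxx. Qed.

Lemma homogE r s x : degrees (eq r) x -> p s x = if s == r then x else 0.
Proof. by move/degrees_homog => <-; rewrite (grading_proj gr). Qed.

Let natE (m : nat) : m%:R = m%:Z%:~R :> R[i]. Proof. by []. Qed.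
Let kN0 : (- k%:Z == 0) = false. Proof. by lia. Qed.
Let k0 : (k%:Z == 0) = false. Proof. by lia. Qed.
Let kNk : (- k%:Z == k%:Z) = false. Proof. by lia. Qed.

Lemma L_alphaE : L_alpha br Gamma amax j = top_zero_bottom k p.
Proof.
rewrite /L_alpha kE natE -mulrNz -[0 : R[i]]/(0%:~R) !g_E.
apply/seteqP; split=> [_ [_ [a ka [b b0 <-]] [c kc <-]]|x xE].
  rewrite /top_zero_bottom /= !linearD/= !(homogE _ ka) !(homogE _ b0) !(homogE _ kc).
  rewrite !eqxx ![0 == _]eq_sym ![k%:Z == - _]eq_sym k0 kN0 kNk !(addr0, add0r).
  by rewrite addrC [c + b]addrC addrA.
exists (p k x + p 0 x).
  exists (p k x); first exact: degrees_proj.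
  by exists (p 0 x) => //; exact: degrees_proj.
exists (p (- k%:Z) x); first exact: degrees_proj.
by rewrite -[RHS]xE addrC [p k x + _]addrC addrA.
Qed.

Lemma P_alphamax_plusE :
  P_alphamax_plus br Gamma amax j = degrees (fun r => r = 0 \/ r = - k%:Z).
Proof.
rewrite /P_alphamax_plus kE natE -mulrNz -[0 : R[i]]/(0%:~R) !g_E.
apply/seteqP; split=> [_ [b b0 [c kc <-]] r rP|x xP].
  by rewrite linearD/= b0 ?kc ?addr0// => rE; apply: rP; auto.
exists (p 0 x); first exact: degrees_proj.
exists (p (- k%:Z) x); first exact: degrees_proj.
apply/eqP; rewrite -subr_eq0; apply/eqP/(grading_eq0 gr) => r.
rewrite linearB linearD/= !(grading_proj gr).
have [->|rk] := eqVneq r (- k%:Z); first by rewrite kN0 add0r subrr.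
have [->|r0] := eqVneq r 0; first by rewrite addr0 subrr.
by rewrite addr0 xP ?subrr// => -[] /eqP; apply/negP.
Qed.

Lemma P_alpha_minusE : P_alpha_minus br Gamma j = degrees (fun r => r <= 0).
Proof.
case: (Gamma_simple) => _ _ rootP.
apply: cartan_root_sumE => // w; split.
  move=> [[wr /(_ j)[m wE]]|[[wr _] w0]]; split=> //.
    by exists (- m%:Z); [rewrite mulrNz|lia].
  by exists 0.
move=> [wr [m wE m0]]; case: (rootP _ wr) => [wp|wn]; last by left.
right; split=> //; case: (wp) => _ /(_ j)[l wl].
have ml : m = l%:Z by apply/eqP; rewrite -(eqr_int R[i]) -wE wl.
by rewrite wE (_ : m = 0)//; lia.
Qed.

Lemma reductive_partE x z : reductive_part br Gamma j x z <-> z = p 0 x.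
Proof.
have nzE : root_sum br [set w | is_root br w /\ coord Gamma j w != 0] =
    degrees (fun r => r <> 0).
  apply: root_sumE => // w; split=> [[wr w0]|[wr [m wE m0]]]; split=> //.
    have [m wE] := root_coord_int Gamma_simple j wr; exists m => //.
    by move: w0; rewrite wE intr_eq0 => /eqP.
  by rewrite wE intr_eq0; apply/eqP.
rewrite /reductive_part nzE -[0 : R[i]]/(0%:~R) g_E; split.
  move=> [/degrees_homog z0 /(_ 0)]; rewrite linearB/= z0 => h0.
  by apply/esym/eqP; rewrite -subr_eq0; apply/eqP/h0 => /(_ erefl).
move=> ->; split; first exact: degrees_proj.
move=> r /contrapT ->; rewrite linearB/= (grading_proj gr) eqxx subrr//.
Qed.

Lemma DeltaE : Delta br Gamma amax j = glued_parabolics k p.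
Proof.
apply/seteqP; split=> -[x y].
  rewrite /Delta /= P_alphamax_plusE P_alpha_minusE.
  move=> [xP yP [z /reductive_partE xz /reductive_partE yz]]; split=> /=.
  - by move=> r /eqP r0 /eqP rk; apply: xP => -[].
  - by move=> r r0; apply: yP; lia.
  - by rewrite -xz.
move=> [/= xP yP xy]; rewrite /Delta /= P_alphamax_plusE P_alpha_minusE; split=> /=.
- move=> r rP; apply: xP; apply/eqP => rE; apply: rP; auto.
- by move=> r /negP r0; apply: yP; lia.
- by exists (p 0 x); apply/reductive_partE.
Qed.

Lemma h_E w : (w (h_ br Gamma amax j) : R[i]) = coord Gamma j w / k%:R.
Proof.
have [t' t'E] := dual_basis_point Gamma_simple
  (fun i => (i == j)%:R / coord Gamma j amax : R[i]).
have kreal : (k%:R : R[i]) \is Num.real by exact: realn.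
have evE s : (forall i, (tnth Gamma i s : R[i]) = (i == j)%:R / coord Gamma j amax) ->
    forall w, (w s : R[i]) = coord Gamma j w / k%:R.
  move=> sE w'; rewrite (dual_evalE Gamma_simple) (bigD1 j)//= sE eqxx mul1r kE.
  by rewrite big1 ?addr0// => i /negPf ij; rewrite sE ij mul0r mulr0.
have [] : [set t | real_cartan br t /\ forall i,
    (tnth Gamma i t : R[i]) = (i == j)%:R / coord Gamma j amax] (h_ br Gamma amax j).
  apply: (@xgetPex _ _ _ (ex_intro _ t' _)); split=> // w' wr.
  rewrite evE//; have [m ->] := root_coord_int Gamma_simple j wr.
  by rewrite realM ?realV ?realz.
by move=> _ hE; exact: evE.
Qed.

(** By [h_E], a root of degree m takes the value m / k at h_j; a series of
    valuation at least m / k has no term u^l with - l < m / k. *)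
Lemma M_E w (m : int) f : coord Gamma j w = m%:~R ->
  M_ w (h_ br Gamma amax j) f ->
  forall l : int, 0 < k%:Z * l + m -> f l = 0.
Proof.
move=> wm [[N fN] fv] l lm; apply/eqP/contraT => fl.
(* The valuation is attained at the largest exponent l + d with f <> 0. *)
have exd : exists d : nat, f (l + d%:Z) != 0 by exists 0%N; rewrite addr0.
have bound d : f (l + d%:Z) != 0 -> (d <= `|(N - l)%R|)%N.
  move=> fd; rewrite leqNgt; apply/negP => dN; case/eqP: fd; apply: fN; lia.
have [d fd dmax] := ex_maxnP exd bound.
have : valuation_inf f (- (l + d%:Z)).
  split; first by rewrite opprK.
  move=> e el; apply/eqP/contraT => fe.
  have := dmax `|(- e - l)%R|%N.
  have -> : l + `|(- e - l)%R|%N%:Z = - e by lia.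
  by move=> /(_ fe); lia.
move=> /fv; rewrite h_E wm ler_pdivrMr ?ltr0n// natE -intrM ler_int; nia.
Qed.

Lemma M_delta w (m : int) (l : int) : coord Gamma j w = m%:~R ->
  k%:Z * l + m <= 0 ->
  M_ w (h_ br Gamma amax j) (fun i => if i == l then 1 else 0).
Proof.
move=> wm lm; split; first by exists l => i il; rewrite ifF//; lia.
move=> e [+ _]; have [el _|_] := eqVneq (- e) l; last by rewrite eqxx.
by rewrite h_E wm ler_pdivrMr ?ltr0n// natE -intrM ler_int; nia.
Qed.

Lemma O_alphaE :
  O_alpha br Gamma amax j `&` laurent_poly g = maximal_loops k p.
Proof.
set M := fun w => tensor_set (M_ w (h_ br Gamma amax j)) (root_space br w).
have M0 w : M w 0 by exact: tensor_set0.
have MD w F1 F2 : M w F1 -> M w F2 -> M w (F1 + F2) by exact: tensor_setD.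
apply/seteqP; split=> [F [[C [Ch C0] [S SM <-]] [lF _]]|F AF].
  split=> // l r lr; rewrite fctE linearD/=.
  have -> : p r (C l) = 0.
    rewrite cartan_degree//; case: eqP => // r0.
    by rewrite C0//; nia.
  rewrite add0r; move: S SM lF => S SM _.
  apply: (@sum_family_ind _ _ _ _ _ (fun F => p r (F l) = 0) _ _ _ S SM) => [||w T wr].
  - by rewrite linear0.
  - by move=> S1 S2 h1 h2; rewrite fctE linearD/= h1 h2 addr0.
  move=> [m [f [x [fx ->]]]]; rewrite linear_sum big1// => i _.
  have [Mf wx] := fx i; have [e we] := root_coord_int Gamma_simple j wr.
  rewrite linearZ/= (root_space_degree r wx we); case: eqP => [re|_].
    by rewrite (M_E we Mf) ?scale0r// -re.
  by rewrite scaler0.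
have lF : laurent g F by case: AF.
split; last by split=> //; exists 1 => l; exact: (maximal_loops_gt1 k_gt0 gr AF).
have O0 : O_alpha br Gamma amax j 0.
  exists 0; first by split=> l *; [exact: mem0v|].
  by exists 0; [exact: sum_family0 M0|rewrite addr0].
have OD F1 F2 : O_alpha br Gamma amax j F1 -> O_alpha br Gamma amax j F2 ->
    O_alpha br Gamma amax j (F1 + F2).
  move=> [C1 [Ch1 C01] [S1 SM1 <-]] [C2 [Ch2 C02] [S2 SM2 <-]].
  exists (C1 + C2).
    by split=> l *; rewrite fctE; [exact: memvD|rewrite C01// C02// addr0].
  by exists (S1 + S2); [exact: (sum_familyD M0 MD SM1 SM2)|rewrite addrACA].
move: F AF {lF}; apply: (maximal_loops_ind k_gt0 gr)
  => [//|F1 F2 _ _|l r x /degrees_homog rx lr]; first exact: OD.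
move: x rx.
apply: (@degrees_ind (eq r) (fun x => O_alpha br Gamma amax j (monomial l x))).
- by rewrite (_ : monomial l 0 = 0)//; apply/funext => i; rewrite /monomial if_same.
- by move=> x y hx hy; rewrite monomialD; exact: OD.
- move=> x xh r0; exists (monomial l x).
    split=> i; rewrite /monomial; first by case: eqP; rewrite ?mem0v.
    by move=> i0; rewrite ifF//; nia.
  by exists 0; [exact: sum_family0 M0|rewrite addr0].
- move=> w m x wr wm rm wx; exists 0; first by split=> i *; [exact: mem0v|].
  exists (monomial l x); last by rewrite add0r.
  apply: (@sum_family1 _ _ _ _ _ _ w) => //.
  have -> : monomial l x = (fun i => (if i == l then 1 else 0) *: x).
    by apply/funext => i; rewrite /monomial; case: eqP; rewrite ?scale1r ?scale0r.
  by apply: tensor_set1 => //; apply: M_delta wm _; rewrite -rm.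
Qed.

End Identification.

(** * The correspondence *)

Theorem theorem2p8 (R : realType) (g : vectType R[i]) (br : g -> g -> g)
    (h : {vspace g}) (n : nat) (Gamma : n.-tuple (dual h)) (amax : dual h)
    (j : 'I_n) :
  lie_bracket br -> simple_lie_algebra br ->
  cartan_subalgebra br h ->
  simple_roots br Gamma -> maximal_root br Gamma amax ->
  exists Phi : set (int -> g) -> set (g * g),
    set_bij
      [set W | [/\ lagrangian_subalgebra (laurent g) (loop_bracket br)
                     (Q_ br (inv_one_minus_u R[i])) W,
                   transversal_in (laurent g) W (taylor g)
                 & W `<=` O_alpha br Gamma amax j `&` laurent_poly g]]
      [set W' | lagrangian_subalgebra (L_alpha br Gamma amax j `*` setT)
                  (pair_bracket br) (Qbar br) W' /\
                transversal_in (L_alpha br Gamma amax j `*` setT) W'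
                  (Delta br Gamma amax j)]
      Phi.
Proof.
move=> br_lie br_simple h_cartan Gamma_simple amax_max.
have [k kE k_gt0] := maximal_root_coord_nat j Gamma_simple amax_max.
have [t [p [tE t_proj proj_eigen /(_ k kE) gr]]] :=
  root_grading j br_lie br_simple h_cartan Gamma_simple amax_max.
rewrite (O_alphaE br_lie h_cartan Gamma_simple tE t_proj proj_eigen gr kE k_gt0).
rewrite (L_alphaE br_lie h_cartan Gamma_simple tE t_proj proj_eigen gr kE k_gt0).
rewrite (DeltaE br_lie h_cartan Gamma_simple tE t_proj proj_eigen gr kE k_gt0).
exists (fun W => loop_specialization k p @` W).
apply: loop_lagrangian_bij => //.
- move=> r s x y px py rs.
  apply: (killing_eigen_orthogonal br_lie (t := vsval t)
    (c := r%:~R) (d := s%:~R)).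
  + by rewrite -px t_proj.
  + by rewrite -py t_proj.
  + by rewrite -intrD intr_eq0.
- apply: (killing_nondegenerate br_lie br_simple).
  exact: (killing_neq0 br_lie h_cartan Gamma_simple j).
Qed.
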